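(* Let $H$ be a real Hilbert space, let $A:H\to 2^{H}$ be maximal monotone, and let $B:H\to H$ be $\beta$-cocoercive for some $\beta>0$. Suppose that $\Omega:=\operatorname{zer}(A+B)\neq\emptyset$. Let $\alpha>0$, let $\{\eta_k\}_{k\in\mathbb N}\in \ell^1_+(\mathbb N)$, and let $\{U_k\}_{k\in\mathbb N}\subset\mathcal P_\alpha(H)$ be such that $$\mu:=\sup_{k\in\mathbb N}\|U_k\|<+\infty\quad\text{and}\quad (1+\eta_k)U_{k+1}\succeq U_k\quad\forall k\in\mathbb N.$$ Let $\{\gamma_k\}$ be real numbers with $\gamma_k\in(0,\frac{2\beta}{\|U_k\|})$ and let $\{\lambda_k\}$ be real numbers with $\lambda_k\in(0,\frac1{\alpha_k})$, where $\alpha_k=\frac{2\beta}{4\beta-\gamma_k\|U_k\|}$, for all $k\in\mathbb N$. Let $\{a_k\}$ and $\{b_k\}$ be sequences in $H$ such that $\sum_{k=0}^{+\infty}\lambda_k\|a_k\|<+\infty$ and $\sum_{k=0}^{+\infty}\lambda_k\|b_k\|<+\infty$. Let $x_0\in H$ and, for $k\in\mathbb N$, set $$y_k=x_k-\gamma_kU_k(Bx_k+b_k),\qquad x_{k+1}=x_k+\lambda_k\big(J_{\gamma_kU_kA}(y_k)+a_k-x_k\big).$$ Then: (i) For any $x^*\in\Omega$, $\lim_{k\to+\infty}\|x_k-x^*\|_{U_k^{-1}}$ exists. Suppose in addition that there are constants $\underline\lambda$ and $\tau$ such that, for all $k$, $0<\underline\lambda\le\lambda_k\le\frac1{\alpha_k}-\tau$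 and $\tau\in(0,\frac1{\alpha_k}-\underline\lambda)$. Then: (ii) $\lim_{k\to+\infty}\|x_k-J_{\gamma_kU_kA}(x_k-\gamma_kU_kBx_k)\|=0$. Suppose in addition to all of the preceding that there is a constant $\underline\gamma$ with $0<\underline\gamma\le\gamma_k$ for all $k$. Then: (iii) $\{x_k\}$ converges weakly to a point in $\Omega$. Suppose further, in addition to all of the preceding, that $\gamma_k\le\frac{2\beta-\epsilon}{\mu}$ for all $k$, where $\epsilon\in(0,2\beta-\mu\underline\gamma)$. Then: (iv) $Bx_k\to Bx^*$ strongly as $k\to+\infty$, where $x^*\in\Omega$.
   Context: $\mathbb N$ is the set of nonnegative integers, and $\ell^1_+(\mathbb N)$ is the set of summable sequences in $[0,+\infty)$. $B:H\to H$ is $\beta$-cocoercive if $\langle x-y,Bx-By\rangle\ge\beta\|Bx-By\|^2$ for all $x,y\in H$. $\operatorname{zer}(A+B)=\{x\in H: 0\in Ax+Bx\}$. For bounded self-adjoint linear operators $U,V$ on $H$, $U\succeq V$ means $\langle Ux,x\rangle\ge\langle Vx,x\rangle$ for all $x\in H$; $\mathcal P_\alpha(H)$ is the set of bounded self-adjoint linear operators $U$ on $H$ with $U\succeq\alpha I$ ($I$ is the identity). $\|U\|$ is the operator norm. For $U\in\mathcal P_\alpha(H)$ with $\alpha>0$, $\|x\|_{U^{-1}}=\sqrt{\langle U^{-1}x,x\rangle}$. For $\gamma>0$, $J_{\gamma UA}=(I+\gamma UA)^{-1}$ is the resolvent of $\gamma UA$, where $(UA)x=\{Uu:u\in Ax\}$;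 it is single-valued and defined on all of $H$. *)

(* Defs.v *)
From HB Require Import structures.
From mathcomp Require Import all_boot all_order all_algebra.
From mathcomp Require Import all_classical all_reals all_analysis.

Set Implicit Arguments.
Unset Strict Implicit.
Unset Printing Implicit Defensive.

Import Order.TTheory GRing.Theory Num.Theory.
Import numFieldNormedType.Exports.

Local Open Scope classical_set_scope.
Local Open Scope ring_scope.

(* A real Hilbert space is a complete normed module [H] together with a
   positive definite symmetric bilinear form [dot] that induces its norm. *)
Definition hilbert_dot (R : realType) (H : completeNormedModType R)
    (dot : {dot H for idfun}) : Prop :=
  forall x : H, dot x x = `|x| ^+ 2.

Section SetValuedOperators.
Context {R : realType} {H : completeNormedModType R}.
Implicit Types A T : H -> set H.

Definition graph A : set (H * H) := [set p | A p.1 p.2].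

Definition monotone (dot : {dot H for idfun}) A : Prop :=
  forall x y u v, A x u -> A y v -> 0 <= dot (x - y) (u - v).

Definition maximal_monotone (dot : {dot H for idfun}) A : Prop :=
  monotone dot A /\
  forall A', monotone dot A' -> graph A `<=` graph A' -> graph A' = graph A.

Definition op_comp (f : H -> H) A : H -> set H := fun x => f @` A x.

Definition op_add A (f : H -> H) : H -> set H :=
  fun x => [set u + f x | u in A x].

Definition op_inv A : H -> set H := fun y => [set x | A x y].

Definition zer A : set H := [set x | A x 0].

(* The selection is the resolvent (Id + T)^-1 whenever the latter is
   single-valued with full domain. *)
Definition resolvent T : H -> H := fun y => xget 0 (op_inv (op_add T idfun) y).

End SetValuedOperators.

Section BoundedOperators.
Context {R : realType} {H : completeNormedModType R}.

Definition cocoercive (dot : {dot H for idfun}) (beta : R) (B : H -> H) : Prop :=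
  forall x y, beta * `|B x - B y| ^+ 2 <= dot (x - y) (B x - B y).

Definition self_adjoint (dot : {dot H for idfun}) (U : H -> H) : Prop :=
  forall x y, dot (U x) y = dot x (U y).

Definition loewner_ge (dot : {dot H for idfun}) (U V : H -> H) : Prop :=
  forall x, dot (V x) x <= dot (U x) x.

(* For linear maps, [bounded_near U (nbhs 0)] is boundedness on bounded sets. *)
Definition P_alpha (dot : {dot H for idfun}) (alpha : R) :
    set {linear H -> H} :=
  [set U : {linear H -> H} | [/\ bounded_near U (nbhs (0 : H)),
     self_adjoint dot U & loewner_ge dot U (alpha \*: idfun)]].

Definition opnorm (U : H -> H) : R :=
  sup [set `|U x| | x in [set x : H | `|x| <= 1]].

(* The selection is the inverse of [U] whenever [U] is bijective. *)
Definition lin_inv (U : H -> H) : H -> H := fun y => xget 0 [set x | U x = y].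

Definition norm_inv (dot : {dot H for idfun}) (U : H -> H) (x : H) : R :=
  Num.sqrt (dot (lin_inv U x) x).

Definition weakly_cvg (dot : {dot H for idfun}) (x : H^nat) (p : H) : Prop :=
  forall z, dot (x n) z @[n --> \oo] --> dot p z.

End BoundedOperators.

Definition ell1_plus (R : realType) : set (R^nat) :=
  [set u : R^nat | (forall n, 0 <= u n) /\ cvgn (series u)].

(* J_{gamma U A} *)
Definition J (R : realType) (H : completeNormedModType R)
    (gamma : R) (U : H -> H) (A : H -> set H) : H -> H :=
  resolvent (op_comp (gamma \*: idfun) (op_comp U A)).

(* Main.v *)
Require Import Defs.
From HB Require Import structures.
From mathcomp Require Import all_boot all_order all_algebra.
From mathcomp Require Import all_classical all_reals all_analysis.
From mathcomp Require Import ring lra.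

Set Implicit Arguments.
Unset Strict Implicit.
Unset Printing Implicit Defensive.

Import Order.TTheory GRing.Theory Num.Theory.
Import numFieldNormedType.Exports.

Local Open Scope classical_set_scope.
Local Open Scope ring_scope.

(** Write M_k for the inverse of U_k, |z|_k for the norm sqrt <M_k z, z>, T_k for
the forward-backward map z |-> J_(gamma_k U_k A) (z - gamma_k U_k B z) and
e_k = x_k - T_k x_k for the residual.  Everything rests on one inequality,
[fb_key]: a zero x* of A + B satisfies -B x* \in A x*, so testing monotonicity
of A between the points T_k x_k and x*, with s = x_k - x* and
d = B x_k - B x*, gives
  <M_k e_k, e_k> + gamma_k <d, s>  <=  <M_k s, e_k> + gamma_k <d, e_k>.
With cocoercivity and Young's inequality this says that a relaxed step
s - lambda_k e_k decreases |s|_k^2 by at least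
lambda_k (1/alpha_k - lambda_k) |e_k|_k^2 ([fb_relaxed]), where
1/alpha_k = 2 - gamma_k |U_k| / (2 beta).

The errors a_k, b_k perturb the step by a summable amount, because the resolvent
is nonexpansive for |.|_k, and going from the metric k to the metric k+1 costs a
factor 1 + eta_k, because inversion reverses the order of positive operators
([inverse_antitone]).  So |x_k - x*|_k is quasi-Fejer monotone and converges
([quasi_fejer_cvg]), which is (i).  The decrease of its square is then
asymptotically zero and bounds a multiple of |e_k|_k^2, which is (ii).

Once gamma_k is bounded below, cocoercivity and [fb_key] bound
beta |B x_k - B x*|^2 by <d, e_k> + <M_k s, e_k> / gamma_k, which tends to 0:
this is (iv), and it is obtained before (iii).  For (iii), the vectors
v_k = M_k e_k / gamma_k - B x_k lie in A (T_k x_k) and converge strongly to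
-B x*, so every weak limit p of x_k along an ultrafilter satisfies
-B x* \in A p, by maximality; cocoercivity gives B p = B x*, and p is a zero of
A + B ([weak_limit_Omega]).  Such limits exist because x_k is
bounded ([bounded_weak_cvg_ultra]).  Two of them, p and q, agree by Opial's
argument: <x_k, M_k (p - q)> converges, being a combination of |x_k - p|_k^2,
|x_k - q|_k^2 and terms free of x_k, and M_k converges strongly since the M_k
decrease up to the factors 1 + eta_k ([variable_metric_cvg]).

The resolvent is everywhere defined by Minty's theorem ([minty]), in the metric
of U_k.  It is proved by minimising over H x H the Fitzpatrick function of A plus
a quadratic form.  This minimisation, the Riesz representation of bounded
functionals (hence weak limits) and the invertibility of the U_k are instances
of one lemma, [uniformly_convex_min]: a supremum of continuous functions that
are uniformly convex with a common modulus attains its minimum, since minimising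
sequences are Cauchy. *)

(** * Minimisation of uniformly convex functions *)

(** Completeness in the form in which parallelogram identities produce Cauchy
sequences.  Stated as a predicate so that it passes to the product V * W with
its maximum norm, over which the minimisation for Minty's theorem takes place. *)
Definition sqr_complete (R : realType) (V : normedModType R) :=
  forall (u : V^nat) (d : R^nat), d @ \oo --> 0 ->
    (forall m n, `|u m - u n| ^+ 2 <= d m + d n) -> exists l : V, u @ \oo --> l.

Lemma completeNormedMod_sqr (R : realType) (V : completeNormedModType R) :
  sqr_complete V.
Proof.
move=> u d d0 ud; apply/cvg_ex; apply: cauchy_cvg; apply: cauchy_exP => e e0.
have e2 : 0 < e ^+ 2 / 2 by rewrite divr_gt0 ?exprn_gt0.
move/cvgrPdist_lt: d0 => /(_ _ e2)[N _ dN].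
have {}dN n : (N <= n)%N -> d n < e ^+ 2 / 2.
  move=> /dN /=; rewrite sub0r normrN; exact: ltr_normlW.
exists (u N); exists N => // n /= Nn; rewrite -ball_normE /=.
rewrite -(@ltr_pXn2r _ 2) ?nnegrE ?(ltW e0)//; apply: (le_lt_trans (ud N n)).
by have := dN _ Nn; have := dN _ (leqnn N); lra.
Qed.

Lemma sqr_complete_prod (R : realType) (V W : normedModType R) :
  sqr_complete V -> sqr_complete W -> sqr_complete (V * W)%type.
Proof.
move=> cV cW u d d0 ud.
have le12 (z : V * W) : `|z.1| <= `|z| /\ `|z.2| <= `|z|.
  by rewrite prod_normE !le_max !lexx orbT.
have [a ua] : exists a : V, (u n).1 @[n --> \oo] --> a.
  apply: (cV _ _ d0) => m n; apply: le_trans (ud m n).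
  by rewrite ler_pXn2r ?nnegrE//; case: (le12 (u m - u n)).
have [b ub] : exists b : W, (u n).2 @[n --> \oo] --> b.
  apply: (cW _ _ d0) => m n; apply: le_trans (ud m n).
  by rewrite ler_pXn2r ?nnegrE//; case: (le12 (u m - u n)).
exists (a, b).
have -> : u = (fun n => ((u n).1, (u n).2)) by apply/funext => n; case: (u n).
exact: cvg_pair ua ub.
Qed.

Section UniformlyConvexMin.
Context {R : realType} {V : normedModType R} (Vcomplete : sqr_complete V).

(** The function minimised is sup_i q_i, which may take the value +oo; comparing it
with a real s by [forall i, q i x <= s] avoids extended reals.  The midpoint of
two almost minimisers cannot go below the infimum, so the convexity gain
c |x - y|^2 is at most the mean of their excesses over it: minimising sequences
are Cauchy, and each inequality q_i <= s passes to the limit. *)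
Lemma uniformly_convex_min (I : Type) (q : I -> V -> R) (c m : R) :
    0 < c -> (forall i, continuous (q i)) ->
    (forall i x y, q i (2^-1 *: (x + y)) <=
                   (q i x + q i y) / 2 - c * `|x - y| ^+ 2) ->
    (forall x s, (forall i, q i x <= s) -> m <= s) ->
    (exists x s, forall i, q i x <= s) ->
  exists x t, (forall i, q i x <= t) /\
    forall y s, (forall i, q i y <= s) -> t <= s.
Proof.
move=> c0 qC qmid qm [x0 [s0 qs0]].
pose S := [set s | exists x, forall i, q i x <= s].
have S0 : S !=set0 by exists s0; exists x0.
have Sm : has_lbound S by exists m => s [x /qm].
have hS : has_inf S by [].
have /choice[xs xsP] n : exists x, forall i, q i x <= inf S + harmonic n.
  have [s [x xs] sS] := inf_adherent (@harmonic_gt0 R n) hS.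
  by exists x => i; apply: (le_trans (xs i)); exact: ltW.
have midS y z s r : (forall i, q i y <= s) -> (forall i, q i z <= r) ->
    inf S <= (s + r) / 2 - c * `|y - z| ^+ 2.
  move=> xs1 ys2; apply: ge_inf => //; exists (2^-1 *: (y + z)) => i.
  apply: (le_trans (qmid i y z)); have := xs1 i; have := ys2 i; lra.
have h0 : (fun n => c^-1 * harmonic n) @ \oo --> (0 : R).
  by rewrite -(mulr0 c^-1); apply: cvgM; [exact: cvg_cst|exact: cvg_harmonic].
have [x xsx] : exists x : V, xs @ \oo --> x.
  apply: (Vcomplete h0) => j k.
  rewrite -mulrDr mulrC ler_pdivlMr// mulrC.
  have := midS (xs j) (xs k) _ _ (xsP j) (xsP k).
  have := @harmonic_ge0 R j; have := @harmonic_ge0 R k; lra.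
exists x, (inf S); split; last first.
  by move=> y s ys; apply: ge_inf => //; exists y.
move=> i.
have qi : q i (xs n) @[n --> \oo] --> q i x.
  by apply: continuous_cvg => //; exact: qC.
have hi : inf S + harmonic n @[n --> \oo] --> inf S.
  rewrite -[X in _ --> X]addr0; apply: cvgD; first exact: cvg_cst.
  exact: cvg_harmonic.
apply: ler_cvg_to qi hi _; apply: nearW => n; exact: xsP.
Qed.

End UniformlyConvexMin.

(** * Inner products *)

Section Dot.
Context {R : realType} {H : completeNormedModType R} (dot : {dot H for idfun}).
Context (Hdot : hilbert_dot dot).
Implicit Types (x y z : H) (U : {linear H -> H}).

Lemma dotC x y : dot x y = dot y x.
Proof. by rewrite hermitian_subproof expr0 mul1r. Qed.

Lemma dotDl x y z : dot (x + y) z = dot x z + dot y z.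
Proof. exact: linearDl. Qed.

Lemma dotDr x y z : dot z (x + y) = dot z x + dot z y.
Proof. exact: linearDr. Qed.

Lemma dotNl x y : dot (- x) y = - dot x y.
Proof. exact: linearNl. Qed.

Lemma dotNr x y : dot x (- y) = - dot x y.
Proof. exact: linearNr. Qed.

Lemma dotZl a x y : dot (a *: x) y = a * dot x y.
Proof. exact: linearZl_LR. Qed.

Lemma dotZr a x y : dot x (a *: y) = a * dot x y.
Proof. exact: linearZr_LR. Qed.

Lemma dot0l x : dot 0 x = 0.
Proof. exact: linear0l. Qed.

Lemma dot0r x : dot x 0 = 0.
Proof. exact: linear0r. Qed.

Definition dotE := (dotDl, dotDr, dotNl, dotNr, dotZl, dotZr).

(** The inner product is continuous because polarisation writes it with norms. *)
Lemma cvg_dot (T : Type) (F : set_system T) {FF : Filter F} (f g : T -> H) a b :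
  f @ F --> a -> g @ F --> b -> dot (f t) (g t) @[t --> F] --> dot a b.
Proof.
have pol x y : dot x y = 4^-1 * (`|x + y| ^+ 2 - `|x - y| ^+ 2).
  by rewrite -!Hdot !dotE (dotC y x); field.
have sqr (h : T -> H) c : h @ F --> c -> `|h t| ^+ 2 @[t --> F] --> `|c| ^+ 2.
  by move=> hc; apply: cvgM; exact: cvg_norm.
move=> fa gb; rewrite pol; under eq_fun do rewrite pol.
by apply: cvgM; [exact: cvg_cst|apply: cvgB; apply: sqr; [exact: cvgD|exact: cvgB]].
Qed.

Lemma quadratic_ge0_discr (a b c : R) : 0 <= c ->
  (forall t, 0 <= a + t * b + t ^+ 2 * c) -> b ^+ 2 <= 4 * a * c.
Proof.
rewrite le_eqVlt => /predU1P[<-|c0] abc.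
  have [->|b0] := eqVneq b 0; first by rewrite expr0n !mulr0.
  by have := abc (- (a + 1) / b); rewrite divfK//; lra.
have := abc (- b / (2 * c)).
have -> : a + - b / (2 * c) * b + (- b / (2 * c)) ^+ 2 * c =
          (4 * a * c - b ^+ 2) / (4 * c) by field; rewrite gt_eqF.
by rewrite pmulr_lge0 ?invr_gt0 ?subr_ge0// mulr_gt0.
Qed.

Lemma psd_cauchy_schwarz U : self_adjoint dot U ->
  (forall x, 0 <= dot (U x) x) ->
  forall x y, dot (U x) y ^+ 2 <= dot (U x) x * dot (U y) y.
Proof.
move=> Usa U0 x y.
have : (2 * dot (U x) y) ^+ 2 <= 4 * dot (U x) x * dot (U y) y.
  apply: quadratic_ge0_discr (U0 y) _ => t.
  have := U0 (x + t *: y).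
  rewrite (linearD U) (linearZ_LR U)/= !dotE (Usa y x) (dotC y (U x)); lra.
by rewrite exprMn -natrX -mulrA ler_pM2l.
Qed.

Lemma dot_cauchy_schwarz x y : `|dot x y| <= `|x| * `|y|.
Proof.
rewrite -ler_sqr ?nnegrE ?mulr_ge0// (real_normK (num_real _)) exprMn -!Hdot.
apply: (@psd_cauchy_schwarz idfun) => [u v|u] //=.
by rewrite Hdot sqr_ge0.
Qed.

(** Cauchy-Schwarz for the form <U x, y> at y = U x gives
|U x|^4 <= <U x, x> <U (U x), U x> <= <U x, x> L |U x|^2. *)
Lemma psd_norm_sqr U (L : R) : self_adjoint dot U ->
  (forall x, 0 <= dot (U x) x) -> (forall x, dot (U x) x <= L * `|x| ^+ 2) ->
  forall x, `|U x| ^+ 2 <= L * dot (U x) x.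
Proof.
move=> Usa U0 UL x.
have [->|Ux0] := eqVneq (U x) 0; first by rewrite normr0 expr0n dot0l mulr0.
have Ux : 0 < `|U x| ^+ 2 by rewrite exprn_gt0 ?normr_gt0.
rewrite -(ler_pM2r Ux) -{1}expr2 -{1}Hdot.
apply: (le_trans (psd_cauchy_schwarz Usa U0 _ _)).
by rewrite mulrAC mulrC ler_wpM2r.
Qed.

(** The solution is the minimiser of z |-> <U z, z> / 2 - f z, whose derivative in
every direction vanishes.  With U the identity this is the Riesz representation
theorem; with f = <y, .> it says that U is onto. *)
Lemma riesz_coercive U (alpha : R) (f : H -> R) (C : R) : 0 < alpha ->
    continuous U -> self_adjoint dot U ->
    (forall x, alpha * `|x| ^+ 2 <= dot (U x) x) ->
    (forall x y, f (x + y) = f x + f y) -> (forall a x, f (a *: x) = a * f x) ->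
    (forall x, `|f x| <= C * `|x|) ->
  exists x, forall z, dot (U x) z = f z.
Proof.
move=> a0 Uc Usa Ua fD fZ fC.
have fB x y : f (x - y) = f x - f y by rewrite -scaleN1r fD fZ mulN1r.
have fcont : continuous f.
  move=> x; apply/subr_cvg0.
  apply: norm_cvg0; apply: (@squeeze_cvgr _ _ _ _ (fun=> 0) (fun z => C * `|z - x|)).
  - by apply: nearW => z /=; rewrite normr_ge0 /= -fB fC.
  - exact: cvg_cst.
  rewrite -[X in _ --> X](mulr0 C); apply: cvgM; first exact: cvg_cst.
  rewrite -(@normr0 _ H); apply: cvg_norm; rewrite -(subrr x).
  by apply: cvgB => //; exact: cvg_cst.
pose q (_ : unit) z := 2^-1 * dot (U z) z - f z.
have [|||||x [t [xt tmin]]] := @uniformly_convex_min R H (@completeNormedMod_sqr R H)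
    unit q (alpha / 8) (- (C ^+ 2 / (2 * alpha))).
- by rewrite divr_gt0.
- move=> [] x; apply: cvgB; last exact: fcont.
  by apply: cvgM; [exact: cvg_cst|apply: cvg_dot => //; exact: Uc].
- move=> [] x y; rewrite /q fZ fD.
  have := Ua (x - y).
  rewrite !(linearZ_LR U, linearD U, linearN U)/= !dotE !(Usa y x) (dotC y (U x)). lra.
- move=> z s /(_ tt); apply: le_trans; rewrite /q.
  have := Ua z; have := fC z; rewrite ler_norml => /andP[_].
  have : 0 <= (alpha * `|z| - C) ^+ 2 / (2 * alpha).
    by rewrite divr_ge0 ?sqr_ge0 ?mulr_ge0 ?ltW.
  have -> : (alpha * `|z| - C) ^+ 2 / (2 * alpha) =
    2^-1 * (alpha * `|z| ^+ 2) - C * `|z| + C ^+ 2 / (2 * alpha).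
    by field; rewrite gt_eqF.
  lra.
- by exists 0, (q tt 0) => -[].
exists x => z; apply/eqP; rewrite -subr_eq0 -sqrf_eq0 eq_le sqr_ge0 andbT.
(* q (x + s z) >= q x for all s: a quadratic in s with zero constant term. *)
have := @quadratic_ge0_discr 0 (dot (U x) z - f z) (2^-1 * dot (U z) z).
rewrite mulr0 mul0r; apply.
  by rewrite mulr_ge0// (le_trans _ (Ua z))// mulr_ge0 ?sqr_ge0 ?ltW.
move=> s; have : q tt x <= q tt (x + s *: z).
  by apply: (le_trans (xt tt)); apply: tmin (x + s *: z) _ _ => -[].
rewrite /q (linearD U) (linearZ_LR U)/= fD fZ !dotE (Usa z x) (dotC z (U x)).
lra.
Qed.

(** Weak compactness of balls: along an ultrafilter each bounded real function
<x t, z> has a limit, which is a bounded linear functional of z. *)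
Lemma bounded_weak_cvg_ultra (T : Type) (F : set_system T) (x : T -> H) (C : R) :
  UltraFilter F -> (forall t, `|x t| <= C) ->
  exists p, forall z, dot (x t) z @[t --> F] --> dot p z.
Proof.
move=> FU xC.
have bnd t z : `|dot (x t) z| <= C * `|z|.
  by apply: (le_trans (dot_cauchy_schwarz _ _)); rewrite ler_wpM2r.
have /choice[f fP] z : exists l : R, dot (x t) z @[t --> F] --> l.
  have [|l [_ lcl]] := @segment_compact R (- (C * `|z|)) (C * `|z|)
      (dot (x t) z @[t --> F]) _.
    by apply: (@filterE _ F) => t; rewrite /= in_itv/= -ler_norml.
  exists l => W Wl /=.
  have [//|FW] := in_ultra_setVsetC ((fun t => dot (x t) z) @^-1` W) FU.
  by have [r []] := lcl (~` W) W FW Wl.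
have fC z : `|f z| <= C * `|z|.
  rewrite ler_norml; apply/andP; split.
    apply: (cvgr_to_ge (fP z)); apply: nearW => t.
    by have := bnd t z; rewrite ler_norml => /andP[].
  apply: (cvgr_to_le (fP z)); apply: nearW => t.
  by have := bnd t z; rewrite ler_norml => /andP[].
have fD y z : f (y + z) = f y + f z.
  have h : dot (x t) (y + z) @[t --> F] --> f y + f z.
    have -> : (fun t => dot (x t) (y + z)) = (fun t => dot (x t) y + dot (x t) z).
      by apply/funext => t; rewrite dotDr.
    exact: cvgD.
  exact: cvg_unique (fP (y + z)) h.
have fZ a z : f (a *: z) = a * f z.
  have h : dot (x t) (a *: z) @[t --> F] --> a * f z.
    have -> : (fun t => dot (x t) (a *: z)) = (fun t => a * dot (x t) z).
      by apply/funext => t; rewrite dotZr.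
    by apply: cvgM => //; exact: cvg_cst.
  exact: cvg_unique (fP (a *: z)) h.
have [||||p pf] := @riesz_coercive idfun 1 f C _ _ _ _ fD fZ fC => //.
- by move=> y; exact: cvg_id.
- by move=> y; rewrite mul1r Hdot.
by exists p => z; have := pf z; rewrite /= => ->; exact: fP.
Qed.

End Dot.

(** * Coercive self-adjoint operators and their inverses *)

Section Operators.
Context {R : realType} {H : completeNormedModType R} (dot : {dot H for idfun}).
Context (Hdot : hilbert_dot dot).
Implicit Types (x y z : H) (U V M N : {linear H -> H}).

Section PositiveOperator.
Context (alpha : R) (alpha_gt0 : 0 < alpha) (U : {linear H -> H}).
Context (PU : P_alpha dot alpha U).

Lemma P_alpha_sa : self_adjoint dot U. Proof. by case: PU. Qed.

Lemma P_alpha_continuous : continuous U.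
Proof. by case: PU => /bounded_linear_continuous. Qed.

Lemma P_alpha_coercive x : alpha * `|x| ^+ 2 <= dot (U x) x.
Proof. by case: PU => _ _ /(_ x) /=; rewrite dotZl Hdot. Qed.

Lemma P_alpha_psd x : 0 <= dot (U x) x.
Proof. by apply: le_trans (P_alpha_coercive x); rewrite mulr_ge0 ?sqr_ge0 ?ltW. Qed.

Lemma has_sup_opnorm : has_sup [set `|U x| | x in [set x : H | `|x| <= 1]].
Proof.
split; first by exists `|U 0|, 0 => //=; rewrite normr0.
case: PU => /linear_boundedP/pinfty_ex_gt0[r r0 Ur] _ _.
exists r => _ [x /= x1 <-]; apply: (le_trans (Ur x)).
by rewrite ler_piMr// ltW.
Qed.

Lemma opnorm_ge0 : 0 <= opnorm U.
Proof.
apply: ub_le_sup; first by have [] := has_sup_opnorm.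
by exists 0; rewrite /= ?linear0 normr0.
Qed.

Lemma le_opnorm x : `|U x| <= opnorm U * `|x|.
Proof.
have [->|x0] := eqVneq x 0; first by rewrite linear0 !normr0 mulr0.
have nx : 0 < `|x| by rewrite normr_gt0.
rewrite -ler_pdivrMr// mulrC -[X in X * _](@gtr0_norm _ `|x|^-1) ?invr_gt0//.
rewrite -normrZ -linearZ_LR; apply: ub_le_sup.
  by have [] := has_sup_opnorm.
exists (`|x|^-1 *: x) => //=.
by rewrite normrZ gtr0_norm ?invr_gt0// mulVf// gt_eqF.
Qed.

Lemma dot_le_opnorm x : dot (U x) x <= opnorm U * `|x| ^+ 2.
Proof.
apply: (le_trans (ler_norm _)); apply: (le_trans (dot_cauchy_schwarz Hdot _ _)).
by rewrite expr2 mulrA ler_wpM2r ?le_opnorm.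
Qed.

Lemma P_alpha_inverse : exists M : {linear H -> H},
  [/\ forall x, lin_inv U x = M x, forall x, U (M x) = x & forall x, M (U x) = x].
Proof.
have Uinj : injective U.
  move=> x y Uxy; apply/eqP; rewrite -subr_eq0 -normr_eq0 -sqrf_eq0.
  rewrite -(mulrI_eq0 _ (lregP (lt0r_neq0 alpha_gt0))) eq_le.
  rewrite mulr_ge0 ?sqr_ge0 ?(ltW alpha_gt0)// andbT.
  by apply: (le_trans (P_alpha_coercive _)); rewrite (linearB U) Uxy subrr dot0l.
have UI x : U (lin_inv U x) = x.
  rewrite /lin_inv; case: xgetP => [y -> //|no].
  have [|||y Uy] := @riesz_coercive _ _ _ Hdot U alpha (dot x) `|x| alpha_gt0
    P_alpha_continuous P_alpha_sa P_alpha_coercive.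
  - by move=> y z; rewrite dotDr.
  - by move=> a y; rewrite dotZr.
  - exact: dot_cauchy_schwarz.
  exfalso; apply: (no y) => /=; apply/eqP; rewrite -subr_eq0 -normr_eq0 -sqrf_eq0.
  by rewrite -Hdot dotDl dotNl Uy subrr.
have Ilin : linear (lin_inv U).
  by move=> a x y; apply: Uinj; rewrite linearP !UI.
pose M := HB.pack_for {linear H -> H} (lin_inv U)
  (GRing.isLinear.Build _ _ _ _ (lin_inv U) Ilin).
by exists M; split => // x; apply: Uinj; rewrite /= UI.
Qed.

Context (M : {linear H -> H}) (UM : forall x, U (M x) = x).

Lemma inverse_sa : self_adjoint dot M.
Proof. by move=> x y; rewrite -{1}(UM y) -P_alpha_sa UM. Qed.

Lemma inverse_coercive x : alpha * `|M x| ^+ 2 <= dot (M x) x.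
Proof. by have := P_alpha_coercive (M x); rewrite UM dotC. Qed.

Lemma inverse_psd x : 0 <= dot (M x) x.
Proof. by apply: le_trans (inverse_coercive x); rewrite mulr_ge0 ?sqr_ge0 ?ltW. Qed.

(** The bound is written without dividing by the operator norm, which vanishes
when H is trivial. *)
Lemma inverse_ge x : `|x| ^+ 2 <= opnorm U * dot (M x) x.
Proof.
have := psd_norm_sqr Hdot P_alpha_sa P_alpha_psd dot_le_opnorm (M x).
by rewrite UM (dotC dot x).
Qed.

Lemma inverse_norm x : alpha * `|M x| <= `|x|.
Proof.
have [->|Mx0] := eqVneq (M x) 0; first by rewrite normr0 mulr0.
have Mx : 0 < `|M x| by rewrite normr_gt0.
rewrite -(ler_pM2r Mx) -mulrA -expr2; apply: (le_trans (inverse_coercive x)).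
by apply: (le_trans (ler_norm _)); rewrite mulrC dot_cauchy_schwarz.
Qed.

Lemma inverse_le x : alpha * dot (M x) x <= `|x| ^+ 2.
Proof.
apply: (@le_trans _ _ (alpha * (`|M x| * `|x|))).
  rewrite ler_pM2l//; apply: (le_trans (ler_norm _)).
  exact: dot_cauchy_schwarz.
by rewrite mulrA expr2 ler_wpM2r ?inverse_norm.
Qed.

Lemma inverse_continuous : continuous M.
Proof.
apply: bounded_linear_continuous; apply/linear_boundedP; exists alpha^-1.
split=> [|r ar x]; first exact: num_real.
apply: (@le_trans _ _ (alpha^-1 * `|x|)); last by rewrite ler_wpM2r// ltW.
by rewrite mulrC ler_pdivlMr// mulrC inverse_norm.
Qed.

End PositiveOperator.

(** Inversion reverses the order: with z = N x, expanding
0 <= <U (c M x - z), c M x - z> bounds 2 c <x, z> by c^2 <M x, x> + <U z, z>,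
and <U z, z> <= c <V z, z> = c <x, z>. *)
Lemma inverse_antitone (alpha c : R) U V M N : 0 < alpha -> 0 < c ->
    P_alpha dot alpha U -> P_alpha dot alpha V ->
    (forall x, U (M x) = x) -> (forall x, V (N x) = x) ->
    loewner_ge dot (c \*: V) U ->
  forall x, dot (N x) x <= c * dot (M x) x.
Proof.
move=> a0 c0 PU PV UM VN cVU x.
have := cVU (N x); rewrite /= dotZl VN (dotC dot x) => UN.
have := P_alpha_psd a0 PU (c *: M x - N x).
rewrite (linearB U) (linearZ_LR U)/= UM !dotE.
rewrite (P_alpha_sa PU (N x) (M x)) UM !(dotC dot x) => h.
rewrite -(ler_pM2l c0).
lra.
Qed.

(** The form in which maximality is used: a pair monotonically related to the
graph of A belongs to it, since adding it keeps A monotone. *)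
Lemma maximal_monotone_mem (A : H -> set H) x u : maximal_monotone dot A ->
  (forall p v, A p v -> 0 <= dot (x - p) (u - v)) -> A x u.
Proof.
move=> [monA maxA] xu.
rewrite -[A x u]/(graph A (x, u)).
rewrite -(maxA (fun a => A a `|` [set b | a = x /\ b = u])) /graph /=.
- by right.
- move=> a b c d [Aac|[-> ->]] [Abd|[-> ->]].
  + exact: monA.
  + by rewrite -(opprB x a) -(opprB u c) dotNl dotNr opprK xu.
  + exact: xu.
  + by rewrite subrr dot0l.
- by move=> z /= ?; left.
Qed.

End Operators.

(** * Minty's theorem and the resolvent *)

Section Minty.
Context {R : realType} {H : completeNormedModType R} (dot : {dot H for idfun}).
Context (Hdot : hilbert_dot dot).
Implicit Types (x y z p v : H) (A : H -> set H).

(** First-order optimality condition on a segment: Y is the second-order term. *)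
Lemma slope_ge0 (X Y : R) :
  (forall s, 0 < s <= 1 -> 0 <= s * X + s ^+ 2 * Y) -> 0 <= X.
Proof.
move=> XY; rewrite leNgt; apply/negP => X0.
pose k := `|Y| - X; have k0 : 0 < k by rewrite subr_gt0 (lt_le_trans X0).
(* As |Y| <= k, the second-order term s |Y| is at most half of - X. *)
pose s := - X / (2 * k).
have s0 : 0 < s by rewrite divr_gt0 ?oppr_gt0 ?mulr_gt0.
have s1 : s <= 1.
  by rewrite ler_pdivrMr ?mulr_gt0// mul1r /k; have := normr_ge0 Y; lra.
have := XY s; rewrite s0 s1 => /(_ isT).
rewrite expr2 -mulrA -mulrDr pmulr_rge0//; apply/negP; rewrite -ltNge.
apply: (@le_lt_trans _ _ (X + s * `|Y|)).
  by rewrite lerD2l ler_wpM2l ?ler_norm ?ltW.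
have -> : X + s * `|Y| = X * ((k + (k - `|Y|)) / (2 * k)).
  by rewrite /s; field; rewrite gt_eqF.
by rewrite nmulr_rlt0// divr_gt0 ?mulr_gt0// /k; have := normr_ge0 Y; lra.
Qed.

(** After the translation by y, the aim is a pair (x, u) of the graph with
x + W u = 0.  The Fitzpatrick function
F (x, u) = sup_(p, v) (<p, u> + <x, v> - <p, v>) of the translated A dominates
<x, u>, so F + Q with Q = (<M x, x> + <W u, u>) / 2 dominates
<M (x + W u), x + W u> / 2 >= 0.  At a minimiser z0 = (x0, u0), comparison with
the points of the graph, where F (p, v) = <p, v>, gives
<p + W u0, v + M x0> >= <M (x0 + W u0), x0 + W u0> >= 0.  Hence
(- W u0, - M x0) belongs to the graph, and evaluating the inequality there forces
x0 + W u0 = 0. *)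
Lemma minty A (W M : {linear H -> H}) (c : R) : maximal_monotone dot A ->
    0 < c -> continuous W -> continuous M ->
    self_adjoint dot W -> (forall x, W (M x) = x) ->
    (forall x, c * `|x| ^+ 2 <= dot (W x) x) ->
    (forall x, c * `|x| ^+ 2 <= dot (M x) x) ->
  forall y, exists p v, A p v /\ p + W v = y.
Proof.
move=> maxA c0 Wc Mc Wsa WM Wge Mge y.
have Msa : self_adjoint dot M by move=> x z; rewrite -{1}(WM z) -Wsa WM.
have square x u : dot (M (x + W u)) (x + W u) =
    dot (M x) x + dot (W u) u + 2 * dot x u.
  have h z : dot (M z) (W u) = dot z u by rewrite -Wsa WM.
  by rewrite (linearD M)/= !dotE !h (Msa (W u)) (dotC dot (W u) (M x)) h; ring.
pose I := {i : H * H | A i.1 i.2}.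
pose F (i : I) (z : H * H) := dot ((sval i).1 - y) z.2 + dot z.1 (sval i).2 -
  dot ((sval i).1 - y) (sval i).2.
pose Q (z : H * H) := 2^-1 * (dot (M z.1) z.1 + dot (W z.2) z.2).
pose q (i : I) (z : H * H) := F i z + Q z.
have monA := maxA.1.
(* Otherwise z would be strictly monotonically related to the graph, hence in
   it, and would satisfy the strict inequality against itself. *)
have Fge (z : H * H) s : (forall i, F i z <= s) -> dot z.1 z.2 <= s.
  move=> Fs; rewrite leNgt; apply/negP => szz.
  have key p v : A p v -> 0 < dot (z.1 + y - p) (z.2 - v).
    move=> Apv; have := Fs (exist _ (p, v) Apv).
    by rewrite /F /= !dotE; lra.
  have /key : A (z.1 + y) z.2.
    by apply: (maximal_monotone_mem maxA) => p v /key/ltW.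
  by rewrite subrr dot0l ltxx.
have Qge (z : H * H) : 0 <= Q z + dot z.1 z.2.
  have := Mge (z.1 + W z.2); rewrite square /Q.
  have : 0 <= c * `|z.1 + W z.2| ^+ 2 by rewrite mulr_ge0 ?sqr_ge0 ?ltW.
  by lra.
have [|||z s qs||z0 [t [z0t tmin]]] := @uniformly_convex_min R (H * H)%type
  (sqr_complete_prod (@completeNormedMod_sqr R H) (@completeNormedMod_sqr R H))
  I q (c / 8) 0.
- by rewrite divr_gt0.
- move=> i [z w].
  have fstc : (fun t : H * H => t.1) @ nbhs (z, w) --> z by exact: cvg_fst.
  have sndc : (fun t : H * H => t.2) @ nbhs (z, w) --> w by exact: cvg_snd.
  apply: cvgD.
    apply: cvgB; last exact: cvg_cst.
    by apply: cvgD; apply: cvg_dot => //; exact: cvg_cst.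
  apply: cvgM; first exact: cvg_cst.
  apply: cvgD; apply: cvg_dot => //.
    by apply: continuous_cvg => //; exact: Mc.
  by apply: continuous_cvg => //; exact: Wc.
- move=> i z w.
  have nle : c * `|z - w| ^+ 2 <=
      c * `|z.1 - w.1| ^+ 2 + c * `|z.2 - w.2| ^+ 2.
    rewrite -mulrDr ler_pM2l// prod_normE/=.
    case: (leP `|z.1 - w.1| `|z.2 - w.2|) => _.
      by rewrite lerDr sqr_ge0.
    by rewrite lerDl sqr_ge0.
  have := Mge (z.1 - w.1); have := Wge (z.2 - w.2).
  rewrite /q /F /Q /= !(linearZ_LR M, linearD M, linearN M)/=.
  rewrite !(linearZ_LR W, linearD W, linearN W)/=.
  rewrite !dotE (Msa w.1 z.1) (dotC dot w.1 (M z.1)).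
  by rewrite (Wsa w.2 z.2) (dotC dot w.2 (W z.2)); lra.
- have := Qge z; have := Fge z (s - Q z).
  have qs' i : F i z <= s - Q z by rewrite lerBrDr; exact: qs.
  by move=> /(_ qs'); lra.
- have [p [v Apv]] : exists p v, A p v.
    apply: contrapT => noA; apply: (noA); exists 0, 0.
    apply: (maximal_monotone_mem maxA) => p v Apv.
    by exfalso; apply: noA; exists p, v.
  exists (p - y, v), (dot (p - y) v + Q (p - y, v)) => -[[p' v'] Ap'].
  rewrite /q lerD2r /F /=.
  have := monA _ _ _ _ Apv Ap'; rewrite !dotE; lra.
pose F0 := t - Q z0.
have F0F i : F i z0 <= F0 by rewrite lerBrDr; exact: z0t.
have F0dot := Fge _ _ F0F.
have tE : t = F0 + Q z0 by rewrite subrK.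
clearbody F0.
(* Compare z0 with the points of the segment from z0 to (p - y, v): each F i is
   affine and Q is quadratic there. *)
have opt p v : A p v ->
    0 <= dot (p - y) v - F0 + (dot (M z0.1) (p - y - z0.1) +
         dot (W z0.2) (v - z0.2)).
  move=> Apv; apply: (@slope_ge0 _ (Q (p - y - z0.1, v - z0.2))) => s /andP[s0 s1].
  have : t <= (1 - s) * F0 + s * dot (p - y) v +
      Q (z0.1 + s *: (p - y - z0.1), z0.2 + s *: (v - z0.2)).
    apply: (tmin (z0.1 + s *: (p - y - z0.1), z0.2 + s *: (v - z0.2))) => i.
    rewrite /q lerD2r.
    have Fi : F i (z0.1 + s *: (p - y - z0.1), z0.2 + s *: (v - z0.2)) =
        (1 - s) * F i z0 + s * F i (p - y, v).
      by rewrite /F /= !dotE; ring.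
    rewrite Fi lerD//; first by rewrite ler_wpM2l ?subr_ge0.
    rewrite ler_wpM2l ?(ltW s0)//.
    case: i {Fi} => -[p' v'] Ap'; rewrite /F /=.
    by have := monA _ _ _ _ Apv Ap'; rewrite !dotE; lra.
  rewrite tE /Q /=.
  rewrite (linearD M) (linearZ_LR M) (linearD W) (linearZ_LR W)/=.
  move: (p - y - z0.1) (v - z0.2) (dot (p - y) v) => d1 d2 pyv.
  rewrite !dotE (Msa d1 z0.1) (dotC dot d1 (M z0.1)).
  by rewrite (Wsa d2 z0.2) (dotC dot d2 (W z0.2)); lra.
have ge p v : A p v ->
  dot (M (z0.1 + W z0.2)) (z0.1 + W z0.2) <= dot (p - y + W z0.2) (v + M z0.1).
  move=> /opt; rewrite square !dotE (Wsa z0.2 (M z0.1)) WM.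
  by rewrite !(dotC dot _ (M z0.1)) (dotC dot z0.2 z0.1); lra.
have mem : A (y - W z0.2) (- M z0.1).
  apply: (maximal_monotone_mem maxA) => p v /ge h.
  have -> : y - W z0.2 - p = - (p - y + W z0.2).
    by rewrite !opprD opprK (addrC (- p)) addrAC.
  have -> : - M z0.1 - v = - (v + M z0.1) by rewrite opprD addrC.
  rewrite dotNl dotNr opprK.
  apply: le_trans h; apply: le_trans (Mge _).
  by rewrite mulr_ge0 ?sqr_ge0 ?ltW.
exists (y - W z0.2), (- M z0.1); split => //.
have := ge _ _ mem; rewrite (addrC y) addrK addNr dot0l.
move/(le_trans (Mge _)); rewrite pmulr_rle0// => h.
have : `|z0.1 + W z0.2| ^+ 2 == 0 by rewrite eq_le h sqr_ge0.
rewrite sqrf_eq0 normr_eq0 addr_eq0 => /eqP h0.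
have -> : W (- M z0.1) = - z0.1 by rewrite (linearN W)/= WM.
by rewrite h0 opprK addrAC addNr add0r.
Qed.

Section Resolvent.
Context (A : H -> set H) (maxA : maximal_monotone dot A).
Context (alpha : R) (alpha_gt0 : 0 < alpha) (U : {linear H -> H}).
Context (PU : P_alpha dot alpha U) (gamma : R) (gamma_gt0 : 0 < gamma).

Lemma resolventP y : exists v, A (J gamma U A y) v /\
  y = J gamma U A y + gamma *: U v.
Proof.
have [M [_ UM _]] := P_alpha_inverse Hdot alpha_gt0 PU.
(* The 1 added to the operator norm keeps m positive when H is trivial. *)
set m := gamma^-1 * (opnorm U + 1)^-1.
have L1 : 0 < opnorm U + 1 by rewrite ltr_pwDr// (opnorm_ge0 PU).
have m0 : 0 < m by rewrite mulr_gt0 ?invr_gt0.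
have ga0 : 0 < gamma * alpha by rewrite mulr_gt0.
have [|||||||p [v [Apv pv]]] := @minty A (gamma \*: U) (gamma^-1 \*: M)
  (Num.min (gamma * alpha) m) maxA _ _ _ _ _ _ _ y.
- by rewrite lt_min ga0 m0.
- by move=> z; apply: cvgZr; exact: (P_alpha_continuous PU).
- by move=> z; apply: cvgZr; exact: (inverse_continuous Hdot alpha_gt0 PU UM).
- by move=> z w /=; rewrite dotZl dotZr (P_alpha_sa PU).
- by move=> z /=; rewrite (linearZ_LR U)/= UM scalerA divff ?scale1r// gt_eqF.
- move=> z /=; rewrite dotZl.
  apply: (@le_trans _ _ (gamma * alpha * `|z| ^+ 2)).
    by rewrite ler_wpM2r ?sqr_ge0// ge_min lexx.
  by rewrite -mulrA ler_pM2l// (P_alpha_coercive Hdot PU).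
- move=> z /=; rewrite dotZl.
  apply: (@le_trans _ _ (m * `|z| ^+ 2)).
    by rewrite ler_wpM2r ?sqr_ge0// ge_min lexx orbT.
  rewrite /m -mulrA ler_pM2l ?invr_gt0// mulrC ler_pdivrMr//.
  have := inverse_ge Hdot alpha_gt0 PU UM z.
  have := inverse_psd Hdot alpha_gt0 PU UM z; lra.
rewrite /J /resolvent; case: xgetP => [q _ [_ [_ [w Aqw <-] <-] /= <-]|no].
  by exists w; rewrite addrC.
exfalso; apply: (no p); exists (gamma *: U v); last by rewrite /= addrC.
by exists (U v) => //; exists v.
Qed.

End Resolvent.

End Minty.

(** * Quasi-Fejer sequences and decreasing metrics *)

Section RealSequences.
Context {R : realType}.
Implicit Types (u eta e r : R^nat).

(** The sequence c is the partial products of 1 + eta, bounded by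
exp (sum of eta). *)
Lemma summable_prod_cvg eta : (forall k, 0 <= eta k) -> cvgn (series eta) ->
  exists c : R^nat, [/\ forall k, c k.+1 = c k * (1 + eta k),
    forall k, 1 <= c k & cvgn c].
Proof.
move=> eta0 setac; pose c k : R := \prod_(0 <= i < k) (1 + eta i); exists c.
have cS k : c k.+1 = c k * (1 + eta k) by rewrite /c big_nat_recr.
have c1 k : 1 <= c k.
  elim: k => [|k IH]; first by rewrite /c big_geq.
  by rewrite cS -[leLHS]mulr1 ler_pM// lerDl.
have c0 k : 0 <= c k := le_trans ler01 (c1 k).
split => //; apply: nondecreasing_is_cvgn.
  apply/nondecreasing_seqP => k.
  by rewrite cS -[leLHS]mulr1 ler_wpM2l// lerDl.
exists (expR (limn (series eta))) => _ [k _ <-].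
apply: (@le_trans _ _ (expR (series eta k))); last first.
  rewrite ler_expR; apply: nondecreasing_cvgn_le => //.
  by apply/nondecreasing_seqP => n; rewrite seriesSr lerDl.
elim: k => [|k IH]; first by rewrite /c big_geq// /series/= big_geq// expR0.
rewrite cS seriesSr expRD; apply: ler_pM => //; first by rewrite addr_ge0.
exact: expR_ge1Dx.
Qed.

(** Dividing by the products c k absorbs the factors 1 + eta k, and subtracting the
partial sums of e makes the sequence nonincreasing. *)
Lemma quasi_fejer_cvg r eta e :
    (forall k, 0 <= r k) -> (forall k, 0 <= eta k) -> (forall k, 0 <= e k) ->
    cvgn (series eta) -> cvgn (series e) ->
    (forall k, r k.+1 <= (1 + eta k) * (r k + e k)) ->
  cvgn r.
Proof.
move=> r0 eta0 e0 seta se rS.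
have [c [cS c1 cc]] := summable_prod_cvg eta0 seta.
have c0 k : 0 < c k := lt_le_trans ltr01 (c1 k).
pose t k := r k / c k.
have tS k : t k.+1 <= t k + e k.
  rewrite /t ler_pdivrMr// cS mulrA (mulrC _ (1 + _)); apply: (le_trans (rS k)).
  rewrite ler_pM2l ?ltr_pwDl// mulrDl divfK ?gt_eqF// lerD2l ler_peMr//.
pose w k := t k - series e k.
have wc : cvgn w.
  apply: nonincreasing_is_cvgn.
    by apply/nonincreasing_seqP => k; rewrite /w seriesSr; have := tS k; lra.
  exists (- limn (series e)) => _ [k _ <-].
  have : series e k <= limn (series e).
    apply: nondecreasing_cvgn_le => //.
    by apply/nondecreasing_seqP => n; rewrite seriesSr lerDl.
  have : 0 <= t k by rewrite /t divr_ge0// ltW.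
  by rewrite /w; lra.
have -> : r = (fun k => (w k + series e k) * c k).
  by apply/funext => k; rewrite /w subrK /t divfK// gt_eqF.
exact: is_cvgM (is_cvgD wc se) cc.
Qed.

End RealSequences.

Section VariableMetric.
Context {R : realType} {H : completeNormedModType R} (dot : {dot H for idfun}).
Context (Hdot : hilbert_dot dot).

(** Divided by the products c k of 1 + eta, the operators decrease, so <N k z, z> converges.
For j <= k the difference D = N j - N k is positive and bounded by L, whence
|D z|^2 <= L <D z, z>, and N k z is Cauchy. *)
Lemma variable_metric_cvg (M : nat -> {linear H -> H}) (eta : R^nat) (L : R) :
    (forall k, 0 <= eta k) -> cvgn (series eta) ->
    (forall k, self_adjoint dot (M k)) ->
    (forall k z, 0 <= dot (M k z) z) ->
    (forall k z, dot (M k z) z <= L * `|z| ^+ 2) ->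
    (forall k z, dot (M k.+1 z) z <= (1 + eta k) * dot (M k z) z) ->
  forall z, cvgn (fun k => M k z).
Proof.
move=> eta0 seta Msa M0 ML MS z.
have [c [cS c1 cc]] := summable_prod_cvg eta0 seta.
have c0 k : 0 < c k := lt_le_trans ltr01 (c1 k).
pose N k : {linear H -> H} := (c k)^-1 \*: M k.
have NE k y : dot (N k y) y = (c k)^-1 * dot (M k y) y by rewrite /N/= dotZl.
have Nsa k : self_adjoint dot (N k) by move=> y w; rewrite /N/= dotZl dotZr Msa.
have MN k : M k z = c k *: N k z.
  by rewrite /N/= scalerA divff ?scale1r// gt_eqF.
clearbody N.
have N0 k y : 0 <= dot (N k y) y by rewrite NE mulr_ge0 ?invr_ge0 ?(ltW (c0 k)).
have NL k y : dot (N k y) y <= L * `|y| ^+ 2.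
  rewrite NE mulrC ler_pdivrMr//; apply: (le_trans (ML k y)).
  by rewrite ler_peMr// (le_trans (M0 k y)).
have NS y : nonincreasing_seq (fun k => dot (N k y) y).
  apply/nonincreasing_seqP => k; rewrite !NE cS invfM.
  by rewrite -mulrA ler_pM2l ?invr_gt0// ler_pdivrMl ?ltr_pwDl.
have nc : cvgn (fun k => dot (N k z) z).
  by apply: nonincreasing_is_cvgn => //; exists 0 => _ [k _ <-].
set l := limn (fun k => dot (N k z) z).
pose d k := L * (dot (N k z) z - l).
have L0 : 0 <= L * `|z| ^+ 2 := le_trans (N0 0 z) (NL 0%N z).
(* L can be negative when H is trivial, hence the case distinction on z. *)
have dpos k : 0 <= d k.
  have lk : l <= dot (N k z) z by exact: nonincreasing_cvgn_ge.
  have [z0|z0] := eqVneq z 0.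
    have E j : dot (N j z) z = 0 by rewrite z0 dot0r.
    by rewrite /d /l (_ : (fun k => dot (N k z) z) = cst 0) ?lim_cst ?E ?subrr ?mulr0//;
      apply/funext => j; rewrite E.
  rewrite /d mulr_ge0 ?subr_ge0//.
  by move: L0; rewrite pmulr_lge0// exprn_gt0 ?normr_gt0.
have Dle j k : (j <= k)%N -> `|N j z - N k z| ^+ 2 <= d j + d k.
  move=> jk; pose D : {linear H -> H} := N j \- N k.
  have := @psd_norm_sqr _ _ _ Hdot D L _ _ _ z.
  rewrite /D/= => /(_ _ _ _)/le_trans; apply.
  - by move=> y w; rewrite /= !dotE !Nsa.
  - by move=> y; rewrite /= !dotE subr_ge0; exact: NS.
  - by move=> y; rewrite /= !dotE; have := NL j y; have := N0 k y; lra.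
  by rewrite !dotE; have := dpos k; rewrite /d; lra.
have d0 : d @ \oo --> 0.
  rewrite -(mulr0 L) -(subrr l); apply: cvgM; first exact: cvg_cst.
  by apply: cvgB => //; exact: cvg_cst.
have [|w Nw] := @completeNormedMod_sqr R H (fun k => N k z) d d0.
  move=> j k; have [jk|/ltnW kj] := leqP j k; first exact: Dle.
  by rewrite distrC (addrC (d j)); exact: Dle.
have -> : (fun k => M k z) = (fun k => c k *: N k z).
  exact/funext.
by apply: (is_cvgZ cc); apply/cvg_ex; exists w.
Qed.

End VariableMetric.

(** * One forward-backward step *)

Definition wnorm (R : realType) (H : completeNormedModType R)
  (dot : {dot H for idfun}) (M : H -> H) (x : H) : R := Num.sqrt (dot (M x) x).

Section WeightedNorm.
Context {R : realType} {H : completeNormedModType R} (dot : {dot H for idfun}).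
Context (M : {linear H -> H}) (Msa : self_adjoint dot M).
Context (M0 : forall x, 0 <= dot (M x) x).
Local Notation nrm := (wnorm dot M).

Lemma wnorm_ge0 x : 0 <= nrm x. Proof. exact: sqrtr_ge0. Qed.

Lemma wnorm_sqr x : nrm x ^+ 2 = dot (M x) x.
Proof. by rewrite sqr_sqrtr. Qed.

Lemma wnorm_le x (a : R) : 0 <= a -> dot (M x) x <= a ^+ 2 -> nrm x <= a.
Proof. by move=> a0 h; rewrite -(ger0_norm a0) -sqrtr_sqr ler_wsqrtr. Qed.

Lemma wnormZ a x : nrm (a *: x) = `|a| * nrm x.
Proof.
by rewrite /wnorm (linearZ_LR M)/= dotZl dotZr mulrA -expr2 sqrtrM ?sqr_ge0// sqrtr_sqr.
Qed.

Lemma wnorm_cauchy_schwarz x y : dot (M x) y <= nrm x * nrm y.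
Proof.
apply: (le_trans (ler_norm _)).
rewrite -ler_sqr ?nnegrE ?mulr_ge0 ?wnorm_ge0// (real_normK (num_real _)).
by rewrite exprMn !wnorm_sqr psd_cauchy_schwarz.
Qed.

Lemma wnorm_triangle x y : nrm (x + y) <= nrm x + nrm y.
Proof.
apply: wnorm_le; first by rewrite addr_ge0 ?wnorm_ge0.
rewrite (linearD M)/= !dotE (Msa y x) (dotC dot y (M x)) sqrrD !wnorm_sqr.
by have := wnorm_cauchy_schwarz x y; lra.
Qed.

End WeightedNorm.

Section ForwardBackwardStep.
Context {R : realType} {H : completeNormedModType R} (dot : {dot H for idfun}).
Context (Hdot : hilbert_dot dot).
Context (A : H -> set H) (maxA : maximal_monotone dot A).
Context (B : H -> H) (beta : R) (beta_gt0 : 0 < beta) (cocoB : cocoercive dot beta B).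
Context (alpha : R) (alpha_gt0 : 0 < alpha) (U : {linear H -> H}).
Context (PU : P_alpha dot alpha U).
Context (M : {linear H -> H}) (UM : forall x, U (M x) = x).
Context (MU : forall x, M (U x) = x) (gamma : R) (gamma_gt0 : 0 < gamma).
Local Notation nrm := (wnorm dot M).
Local Notation Ju := (J gamma U A).
Local Notation fb x := (J gamma U A (x - gamma *: U (B x))).

Let Msa := inverse_sa PU UM.
Let M0 := inverse_psd Hdot alpha_gt0 PU UM.

(** With p the difference of the resolvents and s = y - z, monotonicity gives
<M p, p> <= <M s, p>; conclude by <M (s - p), s - p> >= 0. *)
Lemma resolvent_nonexpansive y z : nrm (Ju y - Ju z) <= nrm (y - z).
Proof.
have [v [Av yE]] := resolventP Hdot maxA alpha_gt0 PU gamma_gt0 y.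
have [w [Aw zE]] := resolventP Hdot maxA alpha_gt0 PU gamma_gt0 z.
have mon := maxA.1 _ _ _ _ Av Aw.
apply: wnorm_le; first exact: wnorm_ge0.
rewrite (wnorm_sqr M0).
have : dot (M (y - z)) (Ju y - Ju z) =
    dot (M (Ju y - Ju z)) (Ju y - Ju z) + gamma * dot (Ju y - Ju z) (v - w).
  have -> : y - z = (Ju y - Ju z) + gamma *: U (v - w).
    by rewrite {1}yE {1}zE (linearB U) scalerBr opprD addrACA.
  by rewrite (linearD M) (linearZ_LR M)/= MU dotDl dotZl (dotC dot (v - w)).
move: mon; move: (Ju y - Ju z) (y - z) (v - w) => p s d mon E.
have gm : 0 <= gamma * dot p d by rewrite mulr_ge0 ?(ltW gamma_gt0).
have := M0 (s - p); rewrite (linearB M)/= !dotE (Msa p s) (dotC dot p (M s)); lra.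
Qed.

(** Monotonicity of A between fb x and xs, where the element of A (fb x) is
M (x - fb x) / gamma - B x and that of A xs is - B xs. *)
Lemma fb_key x xs : zer (op_add A B) xs ->
  dot (M (x - fb x)) (x - fb x) + gamma * dot (B x - B xs) (x - xs) <=
  dot (M (x - xs)) (x - fb x) + gamma * dot (B x - B xs) (x - fb x).
Proof.
move=> [u Au /= uB].
have [v [Av pE]] := resolventP Hdot maxA alpha_gt0 PU gamma_gt0 (x - gamma *: U (B x)).
set p := fb x in Av pE *.
have mon := maxA.1 _ _ _ _ Av Au.
have uE : u = - B xs by apply/eqP; rewrite -addr_eq0 uB.
have ME : M (x - p) = gamma *: (v + B x).
  have -> : x - p = gamma *: U (v + B x).
    have -> : gamma *: U (v + B x) = gamma *: U v + gamma *: U (B x).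
      by rewrite (linearD U) scalerDr.
    by apply/eqP; rewrite subr_eq addrAC (addrC _ p) -pE subrK.
  by rewrite (linearZ_LR M)/= MU.
have gvE : gamma * dot (p - xs) (v - u) =
  dot (M (x - p)) (p - xs) - gamma * dot (B x - B xs) (p - xs).
  rewrite ME uE (dotC dot (p - xs)) dotZl -mulrBr -dotNl -dotDl; congr (_ * dot _ _).
  by rewrite !opprK opprB addrACA subrr addr0.
have gm : 0 <= gamma * dot (p - xs) (v - u) by rewrite mulr_ge0 ?(ltW gamma_gt0).
move: gm; rewrite gvE.
have -> : p - xs = (x - xs) - (x - p) by rewrite opprB [RHS]addrC addrA subrK.
move: (x - p) (x - xs) (B x - B xs) => e s d.
by rewrite !dotE (Msa e s) (dotC dot e (M s)); lra.
Qed.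

(** The term <d, e> of [fb_key] is split by Young's inequality so that its |d|^2
part is exactly absorbed by cocoercivity; what remains is
(2 - gamma |U| / (2 beta)) <M e, e> <= 2 <M s, e>, and the claim follows by
expanding the square. *)
Lemma fb_relaxed x xs (lam : R) : zer (op_add A B) xs -> 0 <= lam ->
  dot (M (x - xs - lam *: (x - fb x))) (x - xs - lam *: (x - fb x)) <=
  dot (M (x - xs)) (x - xs) -
  lam * (2 - gamma * opnorm U / (2 * beta) - lam) *
    dot (M (x - fb x)) (x - fb x).
Proof.
move=> Oxs lam0; have := fb_key x Oxs; have := cocoB x xs.
have := inverse_ge Hdot alpha_gt0 PU UM (x - fb x).
move: (x - fb x) (x - xs) (B x - B xs) => e s d.
rewrite (dotC dot d s) -(Hdot e) -(Hdot d) => eL coco key.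
have young : 2 * dot d e <= 2 * beta * dot d d + dot e e / (2 * beta).
  have : 0 <= dot (2 * beta *: d - e) (2 * beta *: d - e) by rewrite Hdot sqr_ge0.
  rewrite !dotE (dotC dot e d) => h; rewrite -subr_ge0.
  have -> : 2 * beta * dot d d + dot e e / (2 * beta) - 2 * dot d e =
      (4 * beta ^+ 2 * dot d d - 4 * beta * dot d e + dot e e) / (2 * beta).
    by field; rewrite gt_eqF.
  by rewrite divr_ge0 ?mulr_ge0 ?(ltW beta_gt0)//; lra.
have step : (2 - gamma * opnorm U / (2 * beta)) * dot (M e) e <= 2 * dot (M s) e.
  have h1 : gamma * dot e e / (2 * beta) <= gamma * opnorm U / (2 * beta) * dot (M e) e.
    have k0 : 0 <= gamma / (2 * beta).
      by rewrite divr_ge0 ?mulr_ge0 ?(ltW beta_gt0) ?(ltW gamma_gt0).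
    by have := ler_wpM2l k0 eL; lra.
  have h2 : gamma * (2 * dot d e) <= gamma * (2 * beta * dot d d + dot e e / (2 * beta)).
    by rewrite ler_wpM2l// (ltW gamma_gt0).
  have h3 : gamma * (beta * dot d d) <= gamma * dot s d by rewrite ler_wpM2l// (ltW gamma_gt0).
  move: h1 h2 h3; rewrite mulrDr; lra.
rewrite (linearB M) (linearZ_LR M)/= !dotE (Msa e s) (dotC dot e (M s)).
have := ler_wpM2l lam0 step; lra.
Qed.

End ForwardBackwardStep.

(** * Convergence along ultrafilters *)

Section Filters.
Context {R : realType} {H : completeNormedModType R} (dot : {dot H for idfun}).
Context (Hdot : hilbert_dot dot).

(** If the preimage of a neighbourhood W of l were not in F, some ultrafilter finer
than F would contain its complement, and f could not converge to l along it. *)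
Lemma ultra_cvg (T : Type) (S : topologicalType) (F : set_system T)
    (f : T -> S) (l : S) : Filter F ->
  (forall G, UltraFilter G -> F `<=` G -> f @ G --> l) -> f @ F --> l.
Proof.
move=> FF fG W Wl; apply: contrapT => nFW.
have FP : ProperFilter (within (~` (f @^-1` W)) F).
  split; last exact: within_filter.
  move=> F0; apply: nFW; apply: (@filterS _ F _ _ _ _ F0) => t /= h.
  by apply: contrapT => /h.
have [G [GU FG]] := ultraFilterLemma FP.
have sFG : F `<=` G.
  by move=> P FP'; apply: FG; apply: filterS FP' => t Pt _.
have GW : G (f @^-1` W) := fG G GU sFG W Wl.
have GnW : G (~` (f @^-1` W)) by apply: FG; exact: withinT.
by have [t []] := filter_ex (filterI GW GnW).
Qed.

Lemma sub_cvg (T : Type) (S : topologicalType) (F G : set_system T)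
  (f : T -> S) (l : S) : F `<=` G -> f @ F --> l -> f @ G --> l.
Proof. by move=> FG fl W Wl; exact: (FG _ (fl W Wl)). Qed.

Lemma cvg_sqr0 (T : Type) (F : set_system T) {FF : Filter F} (f : T -> R) :
  (forall t, 0 <= f t) -> f t ^+ 2 @[t --> F] --> 0 -> f @ F --> 0.
Proof.
move=> f0 ff; have -> : f = (fun t => Num.sqrt (f t ^+ 2)).
  by apply/funext => t; rewrite sqrtr_sqr ger0_norm.
rewrite -(@sqrtr0 R); apply: continuous_cvg => //; exact: sqrt_continuous.
Qed.

Lemma cvg_ge0_le0 (T : Type) (F : set_system T) {FF : Filter F} (f g : T -> R) :
  (forall t, 0 <= f t <= g t) -> g @ F --> 0 -> f @ F --> 0.
Proof.
by move=> fg g0; apply: (squeeze_cvgr _ (cvg_cst 0) g0); exact: nearW.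
Qed.

Lemma cvg_dot_weak_strong (T : Type) (F : set_system T) {FF : Filter F}
    (x v : T -> H) p w (C : R) : (forall t, `|x t| <= C) ->
  (forall z, dot (x t) z @[t --> F] --> dot p z) -> v @ F --> w ->
  dot (x t) (v t) @[t --> F] --> dot p w.
Proof.
move=> xC xp vw.
have -> : (fun t => dot (x t) (v t)) = (fun t => dot (x t) w + dot (x t) (v t - w)).
  by apply/funext => t; rewrite !dotE addrC subrK.
rewrite -[X in _ --> X]addr0; apply: cvgD; first exact: xp.
apply: norm_cvg0; apply: (@cvg_ge0_le0 _ _ _ _ (fun t => C * `|v t - w|)).
  move=> t; rewrite normr_ge0/=; apply: (le_trans (dot_cauchy_schwarz Hdot _ _)).
  by rewrite ler_wpM2r.
rewrite -(mulr0 C); apply: cvgM; first exact: cvg_cst.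
by rewrite -(@normr0 _ H) -(subrr w); apply: cvg_norm; apply: cvgB => //; exact: cvg_cst.
Qed.

End Filters.

(** * The variable metric forward-backward algorithm *)

Section Algorithm.
Context {R : realType} {H : completeNormedModType R} (dot : {dot H for idfun}).
Context (Hdot : hilbert_dot dot).
Context (A : H -> set H) (maxA : maximal_monotone dot A).
Context (B : H -> H) (beta : R) (beta_gt0 : 0 < beta) (cocoB : cocoercive dot beta B).
Context (alpha : R) (alpha_gt0 : 0 < alpha).
Context (eta : R^nat) (eta_ge0 : forall k, 0 <= eta k) (eta_sum : cvgn (series eta)).
Context (U M : nat -> {linear H -> H}) (PU : forall k, P_alpha dot alpha (U k)).
Context (UM : forall k x, U k (M k x) = x) (MU : forall k x, M k (U k x) = x).
Context (mu : R) (U_le_mu : forall k, opnorm (U k) <= mu).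
Context (U_incr : forall k, loewner_ge dot ((1 + eta k) \*: U k.+1) (U k)).
Context (gamma lambda : R^nat) (gamma_gt0 : forall k, 0 < gamma k).
Context (gamma_lt : forall k, gamma k * opnorm (U k) < 2 * beta).
Context (lambda_gt0 : forall k, 0 < lambda k).
Context (lambda_lt : forall k, lambda k < 2 - gamma k * opnorm (U k) / (2 * beta)).
Context (a b : H^nat).
Context (suma : cvgn (series (fun k => lambda k * `|a k|))).
Context (sumb : cvgn (series (fun k => lambda k * `|b k|))).
Context (x : H^nat).

Local Notation Omega := (zer (op_add A B)).
Local Notation N k := (wnorm dot (M k)).
Local Notation T k := (J (gamma k) (U k) A (x k - gamma k *: U k (B (x k)))).
Local Notation e k := (x k - T k).

Context (xS : forall k, x k.+1 = x k + lambda k *: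
  (J (gamma k) (U k) A (x k - gamma k *: U k (B (x k) + b k)) + a k - x k)).

Let Msa k := inverse_sa (PU k) (UM k).
Let M0 k := inverse_psd Hdot alpha_gt0 (PU k) (UM k).

(** The constants are those of [metric_forward_le] and [metric_le_norm], which
convert the errors b_k and a_k to the metric k. *)
Definition metric_error k : R :=
  2 * beta / Num.sqrt alpha * (lambda k * `|b k|) +
  (Num.sqrt alpha)^-1 * (lambda k * `|a k|).

Lemma metric_error_ge0 k : 0 <= metric_error k.
Proof.
by rewrite addr_ge0 ?mulr_ge0 ?invr_ge0 ?sqrtr_ge0 ?(ltW beta_gt0) ?(ltW (lambda_gt0 k)).
Qed.

Lemma metric_error_sum : cvgn (series metric_error).
Proof.
have -> : metric_error =
    (2 * beta / Num.sqrt alpha) *: (fun k => lambda k * `|b k|) +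
    (Num.sqrt alpha)^-1 *: (fun k => lambda k * `|a k|) by exact/funext.
by apply: is_cvg_seriesD; exact: is_cvg_seriesZ.
Qed.

Lemma metric_le_norm k z : N k z <= (Num.sqrt alpha)^-1 * `|z|.
Proof.
apply: wnorm_le; first by rewrite mulr_ge0 ?invr_ge0 ?sqrtr_ge0.
rewrite exprMn exprVn sqr_sqrtr ?(ltW alpha_gt0)// ler_pdivlMl//.
exact: (inverse_le Hdot alpha_gt0 (PU k) (UM k)).
Qed.

Lemma norm_le_metric k z : `|z| ^+ 2 <= mu * N k z ^+ 2.
Proof.
rewrite (wnorm_sqr (M0 k)).
apply: (le_trans (inverse_ge Hdot alpha_gt0 (PU k) (UM k) z)).
by rewrite ler_wpM2r// M0.
Qed.

(** The square of the left-hand side is gamma_k^2 <U_k z, z>, at most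
gamma_k^2 |U_k| |z|^2.  As gamma_k |U_k| < 2 beta controls gamma_k^2 |U_k|^2, the
missing factor |U_k| is supplied by alpha |z|^2 <= |U_k| |z|^2. *)
Lemma metric_forward_le k z :
  N k (gamma k *: U k z) <= 2 * beta / Num.sqrt alpha * `|z|.
Proof.
apply: wnorm_le; first by rewrite !mulr_ge0 ?invr_ge0 ?sqrtr_ge0 ?(ltW beta_gt0).
rewrite (linearZ_LR (M k))/= MU dotZl dotZr !exprMn exprVn sqr_sqrtr ?(ltW alpha_gt0)//.
rewrite mulrAC ler_pdivlMr// (dotC dot z).
have L0 := opnorm_ge0 (PU k).
have c := P_alpha_coercive Hdot (PU k) z.
have d := dot_le_opnorm Hdot (PU k) z.
have g := ltW (gamma_gt0 k); have gL := ltW (gamma_lt k).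
have gL0 : 0 <= gamma k * opnorm (U k) by rewrite mulr_ge0.
have h1 : (gamma k * opnorm (U k)) ^+ 2 <= (2 * beta) ^+ 2.
  by rewrite ler_pXn2r ?nnegrE// (le_trans gL0).
have h2 : alpha * dot (U k z) z <= opnorm (U k) * (opnorm (U k) * `|z| ^+ 2).
  apply: (@le_trans _ _ (alpha * (opnorm (U k) * `|z| ^+ 2))).
    by rewrite ler_pM2l.
  by rewrite mulrCA ler_wpM2l// (le_trans c).
have h3 := ler_wpM2l (mulr_ge0 g g) h2.
have h4 := ler_wpM2r (sqr_ge0 `|z|) h1.
by rewrite -exprMn; lra.
Qed.

Lemma metric_step_le k xs :
  N k (x k.+1 - xs) <= N k (x k - xs - lambda k *: e k) + metric_error k.
Proof.
rewrite xS; set Jy := J _ _ _ _; set t := T k.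
have -> : x k + lambda k *: (Jy + a k - x k) - xs =
    (x k - xs - lambda k *: (x k - t)) + lambda k *: ((Jy - t) + a k).
  rewrite -[RHS]addrA -scalerN -scalerDr addrAC; congr (_ + _ *: _).
  by rewrite opprB [RHS]addrC [Jy - t + _]addrAC [RHS]addrA subrK.
apply: (le_trans (wnorm_triangle (Msa k) (M0 k) _ _)); rewrite lerD2l.
rewrite wnormZ ger0_norm ?(ltW (lambda_gt0 k))//.
apply: (@le_trans _ _ (lambda k * (2 * beta / Num.sqrt alpha * `|b k| +
    (Num.sqrt alpha)^-1 * `|a k|))).
  rewrite ler_wpM2l ?(ltW (lambda_gt0 k))//.
  apply: (le_trans (wnorm_triangle (Msa k) (M0 k) _ _)); rewrite lerD ?metric_le_norm//.
  apply: (le_trans (resolvent_nonexpansive Hdot maxA alpha_gt0 (PU k) (UM k)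
    (MU k) (gamma_gt0 k) _ _)).
  rewrite opprB addrC addrA subrK -scalerBr -(linearB (U k)) opprD addNKr.
  by rewrite (linearN (U k)) scalerN /wnorm (linearN (M k))/= dotNl dotNr opprK metric_forward_le.
by rewrite /metric_error le_eqVlt; apply/orP; left; apply/eqP; ring.
Qed.

Lemma metric_succ_le k z : N k.+1 z <= (1 + eta k) * N k z.
Proof.
have e1 : 0 < 1 + eta k by rewrite ltr_pwDl.
apply: wnorm_le; first by rewrite mulr_ge0 ?wnorm_ge0 ?(ltW e1).
have := inverse_antitone Hdot alpha_gt0 e1 (PU k) (PU k.+1) (UM k) (UM k.+1) (U_incr k) z.
move/le_trans; apply; rewrite exprMn (wnorm_sqr (M0 k)) ler_wpM2r ?M0//.
by rewrite expr2 ler_peMl ?(ltW e1)// lerDl.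
Qed.

Let rho k := 2 - gamma k * opnorm (U k) / (2 * beta).

Lemma metric_relaxed_sqr k xs : Omega xs ->
  N k (x k - xs - lambda k *: e k) ^+ 2 <=
  N k (x k - xs) ^+ 2 - lambda k * (rho k - lambda k) * N k (e k) ^+ 2.
Proof.
move=> Oxs; rewrite !(wnorm_sqr (M0 k)).
exact: (fb_relaxed Hdot maxA beta_gt0 cocoB alpha_gt0 (PU k) (UM k) (MU k)
  (gamma_gt0 k) _ Oxs (ltW (lambda_gt0 k))).
Qed.

Lemma metric_relaxed k xs : Omega xs ->
  N k (x k - xs - lambda k *: e k) <= N k (x k - xs).
Proof.
move=> Oxs; rewrite -ler_sqr ?nnegrE ?wnorm_ge0//.
apply: (le_trans (metric_relaxed_sqr k Oxs)); rewrite lerBlDr lerDl.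
have h : 0 <= rho k - lambda k by rewrite subr_ge0 ltW ?lambda_lt.
by rewrite mulr_ge0 ?sqr_ge0// mulr_ge0 ?(ltW (lambda_gt0 k)).
Qed.

Lemma metric_dist_cvg xs : Omega xs -> cvgn (fun k => N k (x k - xs)).
Proof.
move=> Oxs; apply: (quasi_fejer_cvg _ eta_ge0 metric_error_ge0 eta_sum metric_error_sum).
  by move=> k; exact: wnorm_ge0.
move=> k; apply: (le_trans (metric_succ_le k _)); rewrite ler_wpM2l ?addr_ge0//.
by apply: (le_trans (metric_step_le k xs)); rewrite lerD2r metric_relaxed.
Qed.

Lemma metric_dist_bounded xs : Omega xs ->
  exists2 C, 0 <= C & forall k, N k (x k - xs) <= C.
Proof.
move=> /metric_dist_cvg/cvg_seq_bounded/pinfty_ex_gt0[C C0 hC].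
exists C; first exact: ltW.
move=> k; have := hC k I; exact: le_trans (ler_norm _).
Qed.

(** Squaring the perturbed step, |x_(k+1) - xs|_(k+1)^2 is at most
(1 + eta_k) (r_k^2 - c |e_k|_k^2 + 2 C E_k + E_k^2), with r_k = |x_k - xs|_k <= C
and E_k the error.  As r_k converges and eta_k, E_k tend to 0, the term
c |e_k|_k^2 is squeezed to 0. *)
Lemma metric_residual_cvg0 xs (c : R) : Omega xs -> 0 < c ->
    (forall k, c <= lambda k * (rho k - lambda k)) ->
  N k (e k) @[k --> \oo] --> 0.
Proof.
move=> Oxs c0 cl; have [C C0 rC] := metric_dist_bounded Oxs.
have /cvg_ex[/= l rl] := metric_dist_cvg Oxs.
pose r k := N k (x k - xs); pose E := metric_error.
have E0 : E @ \oo --> 0 := cvg_series_cvg_0 metric_error_sum.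
have eta0 : eta @ \oo --> 0 := cvg_series_cvg_0 eta_sum.
pose z k := c^-1 * ((1 + eta k) * (r k ^+ 2 + 2 * C * E k + E k ^+ 2) - r k.+1 ^+ 2).
have z0 : z @ \oo --> 0.
  have -> : (0 : R) = c^-1 * ((1 + 0) * (l ^+ 2 + 2 * C * 0 + 0 ^+ 2) - l ^+ 2) by ring.
  have r2 : r k ^+ 2 @[k --> \oo] --> l ^+ 2 by exact: cvgM.
  have r2S : r k.+1 ^+ 2 @[k --> \oo] --> l ^+ 2.
    by have := r2; rewrite -(cvg_shiftS (fun k => r k ^+ 2)).
  apply: cvgM; first exact: cvg_cst.
  apply: cvgB => //; apply: cvgM; first by apply: cvgD => //; exact: cvg_cst.
  apply: cvgD; last exact: cvgM.
  by apply: cvgD => //; apply: cvgM => //; exact: cvg_cst.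
apply: cvg_sqr0; first by move=> k; exact: wnorm_ge0.
apply: cvg_ge0_le0 z0 => k; rewrite sqr_ge0/= /z ler_pdivlMl//.
have E0k : 0 <= E k := metric_error_ge0 k.
set w := N k (x k - xs - lambda k *: e k).
have w0 : 0 <= w by exact: wnorm_ge0.
have wr : w <= r k by exact: metric_relaxed.
have w2 : w ^+ 2 <= r k ^+ 2 - c * N k (e k) ^+ 2.
  apply: (le_trans (metric_relaxed_sqr k Oxs)); rewrite lerD2l lerN2.
  by rewrite ler_wpM2r ?sqr_ge0.
have rS : r k.+1 ^+ 2 <= (1 + eta k) * (w + E k) ^+ 2.
  rewrite (wnorm_sqr (M0 k.+1)).
  have e1 : 0 < 1 + eta k by rewrite ltr_pwDl.
  apply: (le_trans (inverse_antitone Hdot alpha_gt0 e1 (PU k) (PU k.+1) (UM k)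
    (UM k.+1) (U_incr k) _)).
  rewrite ler_pM2l// -(wnorm_sqr (M0 k)) ler_pXn2r ?nnegrE ?wnorm_ge0 ?(addr_ge0 w0 E0k)//.
  exact: metric_step_le.
have wE : (w + E k) ^+ 2 <= r k ^+ 2 - c * N k (e k) ^+ 2 + 2 * C * E k + E k ^+ 2.
  have : w * E k <= C * E k by rewrite ler_wpM2r// (le_trans wr)// rC.
  by rewrite sqrrD; lra.
have e0k : 0 <= eta k * (c * N k (e k) ^+ 2).
  by rewrite mulr_ge0// mulr_ge0 ?(ltW c0)// sqr_ge0.
have := ler_wpM2l (addr_ge0 ler01 (eta_ge0 k)) wE; lra.
Qed.

Section VanishingResidual.
Context (residual0 : N k (e k) @[k --> \oo] --> 0).
Context (gamma_low : R) (gamma_low_gt0 : 0 < gamma_low).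
Context (gamma_ge : forall k, gamma_low <= gamma k).

Lemma residual_norm_cvg0 : `|e k| @[k --> \oo] --> 0.
Proof.
apply: cvg_sqr0 => //.
apply: (@cvg_ge0_le0 _ _ _ _ _ (fun k => mu * N k (e k) ^+ 2)).
  by move=> k; rewrite sqr_ge0 norm_le_metric.
have -> : (0 : R) = mu * 0 ^+ 2 by rewrite expr0n mulr0.
by apply: cvgM; [exact: cvg_cst|exact: cvgM].
Qed.

Lemma x_bounded xs : Omega xs -> exists2 C, 0 <= C & forall k, `|x k - xs| <= C.
Proof.
move=> Oxs; have [C C0 rC] := metric_dist_bounded Oxs.
have mu0 : 0 <= mu := le_trans (opnorm_ge0 (PU 0%N)) (U_le_mu 0%N).
exists (Num.sqrt mu * C) => [|k]; first by rewrite mulr_ge0 ?sqrtr_ge0.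
rewrite -ler_sqr ?nnegrE ?mulr_ge0 ?sqrtr_ge0// exprMn sqr_sqrtr//.
apply: (le_trans (norm_le_metric k _)); rewrite ler_wpM2l//.
by rewrite ler_sqr ?nnegrE ?wnorm_ge0.
Qed.

(** By cocoercivity and [fb_key], beta |B x_k - B xs|^2 is at most
<B x_k - B xs, e_k> + <M_k (x_k - xs), e_k> / gamma_k, and both terms vanish. *)
Lemma Bx_cvg xs : Omega xs -> B (x k) @[k --> \oo] --> B xs.
Proof.
move=> Oxs; have [C C0 rC] := metric_dist_bounded Oxs; have [D D0 xD] := x_bounded Oxs.
apply/subr_cvg0; apply: norm_cvg0; apply: cvg_sqr0 => //.
pose z k := beta^-1 * (beta^-1 * D * `|e k| + gamma_low^-1 * C * N k (e k)).
have z0 : z @ \oo --> 0.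
  have -> : (0 : R) = beta^-1 * (beta^-1 * D * 0 + gamma_low^-1 * C * 0) by ring.
  apply: cvgM; first exact: cvg_cst.
  apply: cvgD; apply: cvgM => //; try exact: cvg_cst.
  exact: residual_norm_cvg0.
apply: cvg_ge0_le0 z0 => k; rewrite sqr_ge0/= /z ler_pdivlMl//.
have coco := cocoB (x k) xs.
have cs1 := le_trans (ler_norm _) (dot_cauchy_schwarz Hdot (x k - xs) (B (x k) - B xs)).
have cs2 := le_trans (ler_norm _) (dot_cauchy_schwarz Hdot (B (x k) - B xs) (e k)).
have dD : `|B (x k) - B xs| <= beta^-1 * D.
  rewrite ler_pdivlMl//; set d := `|_| in coco cs1 *.
  have [->|d0] := eqVneq d 0; first by rewrite mulr0.
  have dp : 0 < d by rewrite lt_def d0 normr_ge0.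
  rewrite -(ler_pM2r dp) -mulrA -expr2 (le_trans coco)// (le_trans cs1)//.
  by rewrite ler_wpM2r ?xD ?(ltW dp).
have key := fb_key Hdot maxA alpha_gt0 (PU k) (UM k) (MU k) (gamma_gt0 k) (x k) Oxs.
have Mee := M0 k (e k).
have Mse : dot (M k (x k - xs)) (e k) <= C * N k (e k).
  apply: (le_trans (wnorm_cauchy_schwarz (Msa k) (M0 k) _ _)).
  by rewrite ler_wpM2r ?wnorm_ge0.
have Ne0 : 0 <= C * N k (e k) by rewrite mulr_ge0 ?wnorm_ge0.
apply: (le_trans coco); rewrite dotC.
have key2 : gamma k * (dot (B (x k) - B xs) (x k - xs) - dot (B (x k) - B xs) (e k))
    <= C * N k (e k) by lra.
have : dot (B (x k) - B xs) (x k - xs) - dot (B (x k) - B xs) (e k) <=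
    gamma_low^-1 * C * N k (e k).
  rewrite -mulrA ler_pdivlMl//; set w := _ - _ in key2 *.
  have [w0|w0] := leP w 0.
    by apply: le_trans Ne0; rewrite mulr_ge0_le0 ?(ltW gamma_low_gt0).
  by apply: le_trans key2; rewrite ler_wpM2r ?gamma_ge ?(ltW w0).
have := ler_wpM2r (normr_ge0 (e k)) dD; lra.
Qed.

Lemma M_cvg z : cvgn (fun k => M k z).
Proof.
apply: (variable_metric_cvg Hdot (L := alpha^-1) eta_ge0 eta_sum Msa M0).
- by move=> k y; rewrite ler_pdivlMl// (inverse_le Hdot alpha_gt0 (PU k) (UM k)).
- move=> k y; have e1 : 0 < 1 + eta k by rewrite ltr_pwDl.
  exact: (inverse_antitone Hdot alpha_gt0 e1 (PU k) (PU k.+1) (UM k) (UM k.+1) (U_incr k)).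
Qed.

(** Demiclosedness: v_k in A (T_k x_k) converges strongly, to - B xs, and T_k x_k
converges weakly along F to p, so the monotonicity inequalities pass to the limit
and maximality puts (p, - B xs) in the graph.  The same weak-strong passage to the
limit in the cocoercivity inequality gives B p = B xs. *)
Lemma weak_limit_Omega (F : set_system nat) p xs : UltraFilter F -> \oo `<=` F ->
  Omega xs -> (forall z, dot (x n) z @[n --> F] --> dot p z) -> Omega p.
Proof.
move=> FU ooF Oxs xp; have [D D0 xD] := x_bounded Oxs.
have xC k : `|x k| <= D + `|xs|.
  by rewrite -[x k](subrK xs) (le_trans (ler_normD _ _))// lerD2r xD.
have /choice[v vP] k : exists v, A (T k) v /\ M k (e k) = gamma k *: (v + B (x k)).
  have [v [Av vE]] := resolventP Hdot maxA alpha_gt0 (PU k) (gamma_gt0 k)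
    (x k - gamma k *: U k (B (x k))).
  exists v; split => //.
  have -> : e k = gamma k *: U k (v + B (x k)).
    rewrite (linearD (U k)) scalerDr.
    by apply/eqP; rewrite subr_eq addrAC (addrC _ (T k)) -vE subrK.
  by rewrite (linearZ_LR (M k))/= MU.
have e0 : (fun k => e k) @ \oo --> 0 by apply: norm_cvg0; exact: residual_norm_cvg0.
have vB0 : (fun k => v k + B (x k)) @ \oo --> 0.
  apply: norm_cvg0.
  apply: (@cvg_ge0_le0 _ _ _ _ _ (fun k => gamma_low^-1 * (Num.sqrt alpha)^-1 * N k (e k))).
    move=> k; rewrite normr_ge0/= -mulrA ler_pdivlMl// ler_pdivlMl ?sqrtr_gt0//.
    apply: (@le_trans _ _ (Num.sqrt alpha * `|M k (e k)|)).
      have [_ ->] := vP k; rewrite normrZ gtr0_norm// ler_wpM2l ?sqrtr_ge0//.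
      by rewrite ler_wpM2r.
    rewrite -ler_sqr ?nnegrE ?mulr_ge0 ?wnorm_ge0 ?sqrtr_ge0// exprMn sqr_sqrtr ?(ltW alpha_gt0)//.
    rewrite (wnorm_sqr (M0 k)); exact: (inverse_coercive Hdot (PU k) (UM k)).
  have -> : (0 : R) = gamma_low^-1 * (Num.sqrt alpha)^-1 * 0 by rewrite mulr0.
  by apply: cvgM => //; exact: cvg_cst.
have Bxs := Bx_cvg Oxs.
have vl : v @ \oo --> - B xs.
  have -> : v = (fun k => (v k + B (x k)) - B (x k)) by apply/funext => k; rewrite addrK.
  by rewrite -[X in _ --> X]sub0r; exact: cvgB.
have BF := sub_cvg ooF Bxs; have vF := sub_cvg ooF vl; have eF := sub_cvg ooF e0.
have cstF (c : H) : cst c @ F --> c by exact: cvg_cst.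
have Bp : B p = B xs.
  have BpF : B (x n) - B p @[n --> F] --> B xs - B p.
    exact: cvgB BF (cstF (B p)).
  have lim : dot (x n - p) (B (x n) - B p) @[n --> F] --> dot (p - p) (B xs - B p).
    have -> : (fun n => dot (x n - p) (B (x n) - B p)) =
        (fun n => dot (x n) (B (x n) - B p) - dot p (B (x n) - B p)).
      by apply/funext => n; rewrite !dotDl !dotNl.
    rewrite dotDl dotNl; apply: cvgB; last first.
      exact: (@cvg_dot _ _ _ Hdot _ _ _ (fun=> p) _ _ _ (cstF p) BpF).
    exact: (cvg_dot_weak_strong Hdot xC xp BpF).
  have lim2 : beta * `|B (x n) - B p| ^+ 2 @[n --> F] --> beta * `|B xs - B p| ^+ 2.
    apply: cvgM; first exact: cvg_cst.
    by apply: cvgM; apply: cvg_norm.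
  have : beta * `|B xs - B p| ^+ 2 <= dot (p - p) (B xs - B p).
    by apply: ler_cvg_to lim2 lim _; apply: nearW => n; exact: cocoB.
  rewrite subrr dot0l pmulr_rle0// => h.
  have : `|B xs - B p| ^+ 2 == 0 by rewrite eq_le h sqr_ge0.
  by rewrite sqrf_eq0 normr_eq0 subr_eq0 => /eqP.
exists (- B xs); last by rewrite /= Bp addNr.
apply: (maximal_monotone_mem maxA) => q w Aqw.
have lim : dot (T n - q) (v n - w) @[n --> F] --> dot (p - q) (- B xs - w).
  have -> : (fun n => dot (T n - q) (v n - w)) =
      (fun n => dot (x n) (v n - w) - dot (e n + q) (v n - w)).
    apply/funext => n; rewrite -dotNl -dotDl; congr (dot _ _).
    by move: (T n) => t; rewrite opprD opprB addrA [x n + _]addrC subrK.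
  have vwF : v n - w @[n --> F] --> - B xs - w by exact: cvgB vF (cstF w).
  rewrite dotDl dotNl; apply: cvgB.
    exact: (cvg_dot_weak_strong Hdot xC xp vwF).
  have eqF : e n + q @[n --> F] --> q.
    by rewrite -{2}[q]add0r; exact: (cvgD eF (cstF q)).
  exact: (cvg_dot Hdot eqF vwF).
apply: (cvgr_to_ge lim); apply: nearW => n.
exact: maxA.1 _ _ _ _ (vP n).1 Aqw.
Qed.

(** Opial's argument: two weak limits p and q along ultrafilters are zeros, so
<x_k, M_k (p - q)> converges along the whole sequence; its limits along the two
ultrafilters are <p, M w> and <q, M w> with w = p - q and M w the limit of M_k w,
hence <w, M w> = 0 and w = 0. *)
Lemma x_weakly_cvg xs : Omega xs -> exists2 p, Omega p & weakly_cvg dot x p.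
Proof.
move=> Oxs; have [D D0 xD] := x_bounded Oxs.
have xC k : `|x k| <= D + `|xs|.
  by rewrite -[x k](subrK xs) (le_trans (ler_normD _ _))// lerD2r xD.
have [F [FU ooF]] := @ultraFilterLemma nat \oo _.
have [p xp] := bounded_weak_cvg_ultra Hdot FU xC.
have Op := weak_limit_Omega FU ooF Oxs xp.
exists p => // z; apply: ultra_cvg => G GU ooG.
have [q xq] := bounded_weak_cvg_ultra Hdot GU xC.
have Oq := weak_limit_Omega GU ooG Oxs xq.
suff -> : p = q by exact: xq.
pose w : H := p - q.
have /cvg_ex[/= Mw Mwl] := @M_cvg w.
have quad y : cvgn (fun k => dot (M k y) y).
  have /cvg_ex[/= l yl] := @M_cvg y.
  by apply/cvg_ex; exists (dot l y); apply: cvg_dot => //; exact: cvg_cst.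
have [l hl] : exists l : R, dot (x k) (M k w) @[k --> \oo] --> l.
  have N2 y : Omega y -> cvgn (fun k => N k (x k - y) ^+ 2).
    by move=> /metric_dist_cvg h; apply: is_cvgM.
  have -> : (fun k => dot (x k) (M k w)) = (fun k => 2^-1 *
      (N k (x k - q) ^+ 2 - N k (x k - p) ^+ 2 + (dot (M k p) p - dot (M k q) q))).
    apply/funext => k.
    have expand y : N k (x k - y) ^+ 2 =
        dot (M k (x k)) (x k) - 2 * dot (x k) (M k y) + dot (M k y) y.
      rewrite (wnorm_sqr (M0 k)) (linearB (M k))/= !dotE.
      by rewrite (Msa k (x k) y) (dotC dot (M k y) (x k)); ring.
    by rewrite !expand (linearB (M k))/= dotDr dotNr; field.
  apply/cvg_ex; apply: is_cvgM; first exact: is_cvg_cst.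
  by apply: is_cvgD; apply: is_cvgB => //; exact: N2.
have pl : dot p Mw = l.
  apply: (cvg_unique _ _ (sub_cvg ooF hl)) => //.
  exact: (cvg_dot_weak_strong Hdot xC xp (sub_cvg ooF Mwl)).
have ql : dot q Mw = l.
  apply: (cvg_unique _ _ (sub_cvg ooG hl)) => //.
  exact: (cvg_dot_weak_strong Hdot xC xq (sub_cvg ooG Mwl)).
have w0 : `|w| ^+ 2 <= mu * dot Mw w.
  have lim : mu * dot (M k w) w @[k --> \oo] --> mu * dot Mw w.
    by apply: cvgM; [exact: cvg_cst|apply: cvg_dot => //; exact: cvg_cst].
  apply: (cvgr_to_ge lim); apply: nearW => k.
  by rewrite -(wnorm_sqr (M0 k)) norm_le_metric.
have : `|w| ^+ 2 == 0.
  by rewrite eq_le sqr_ge0 andbT (le_trans w0)// dotC /w dotDl dotNl pl ql subrr mulr0.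
by rewrite sqrf_eq0 normr_eq0 subr_eq0 => /eqP.
Qed.

End VanishingResidual.

End Algorithm.

(** * Convergence theorem *)

(* The bounds on gamma_k are written gamma_k * ||U_k|| < 2 beta and
   gamma_k * mu <= 2 beta - eps; this agrees with the quotient form as soon as
   H is nontrivial (||U_k|| >= alpha > 0) and keeps the case H = {0}, where
   ||U_k|| = mu = 0, instead of dividing by zero there. *)
Theorem theorem3p1 (R : realType) (H : completeNormedModType R)
    (dot : {dot H for idfun}) (Hdot : hilbert_dot dot)
    (A : H -> set H) (B : H -> H) (beta : R)
    (maxA : maximal_monotone dot A)
    (beta_gt0 : 0 < beta) (cocoB : cocoercive dot beta B)
    (Omega : set H) (defOmega : Omega = zer (op_add A B))
    (Omega_neq0 : Omega !=set0)
    (alpha : R) (alpha_gt0 : 0 < alpha)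
    (eta : R^nat) (eta_l1 : ell1_plus eta)
    (U : nat -> {linear H -> H}) (U_P : forall k, P_alpha dot alpha (U k))
    (mu : R) (U_bounded : has_ubound (range (fun k => opnorm (U k))))
    (defmu : mu = sup (range (fun k => opnorm (U k))))
    (U_incr : forall k, loewner_ge dot ((1 + eta k) \*: U k.+1) (U k))
    (gamma lambda : R^nat)
    (gammaP : forall k, 0 < gamma k /\ gamma k * opnorm (U k) < 2 * beta)
    (alpha_ : R^nat)
    (defalpha_ : forall k,
       alpha_ k = (2 * beta) / (4 * beta - gamma k * opnorm (U k)))
    (lambdaP : forall k, 0 < lambda k < 1 / alpha_ k)
    (a b : H^nat)
    (suma : cvgn (series (fun k => lambda k * `|a k|)))
    (sumb : cvgn (series (fun k => lambda k * `|b k|)))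
    (x y : H^nat)
    (defy : forall k, y k = x k - gamma k *: U k (B (x k) + b k))
    (defx : forall k,
       x k.+1 = x k + lambda k *: (J (gamma k) (U k) A (y k) + a k - x k)) :
  (forall xstar, Omega xstar ->
     cvgn (fun k => norm_inv dot (U k) (x k - xstar)))
  /\
  (forall lambda_low tau : R,
     (forall k, [/\ 0 < lambda_low,
                    lambda_low <= lambda k,
                    lambda k <= 1 / alpha_ k - tau &
                    0 < tau < 1 / alpha_ k - lambda_low]) ->
     (`|x k - J (gamma k) (U k) A (x k - gamma k *: U k (B (x k)))|
        @[k --> \oo] --> (0 : R))
     /\
     (forall gamma_low : R,
        0 < gamma_low -> (forall k, gamma_low <= gamma k) ->
        (exists2 xbar, Omega xbar & weakly_cvg dot x xbar)
        /\
        (forall eps : R,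
           0 < eps < 2 * beta - mu * gamma_low ->
           (forall k, gamma k * mu <= 2 * beta - eps) ->
           forall xstar, Omega xstar -> B (x k) @[k --> \oo] --> B xstar))).
Proof.
have [eta0 etac] := eta_l1.
have muU k : opnorm (U k) <= mu by rewrite defmu; apply: ub_le_sup => //; exists k.
have [M MP] := choice (fun k => P_alpha_inverse Hdot alpha_gt0 (U_P k)).
have MI k : lin_inv (U k) = M k by apply/funext => z; have [] := MP k.
have UM k z : U k (M k z) = z by have [] := MP k.
have MU k z : M k (U k z) = z by have [] := MP k.
have gamma0 k := (gammaP k).1; have gammaU k := (gammaP k).2.
have alphaE k : 1 / alpha_ k = 2 - gamma k * opnorm (U k) / (2 * beta).
  have := gammaU k; rewrite defalpha_ => gU.
  by field; rewrite gt_eqF//=; lra.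
have lambda0 k : 0 < lambda k by have /andP[] := lambdaP k.
have lambda1 k : lambda k < 2 - gamma k * opnorm (U k) / (2 * beta).
  by rewrite -alphaE; have /andP[] := lambdaP k.
have xS k : x k.+1 = x k + lambda k *:
    (J (gamma k) (U k) A (x k - gamma k *: U k (B (x k) + b k)) + a k - x k).
  by rewrite defx defy.
have [xs0 Oxs0] := Omega_neq0; rewrite defOmega in Oxs0 *.
split=> [xs Oxs|lambda_low tau lP].
  rewrite (_ : (fun k => _) = fun k => wnorm dot (M k) (x k - xs)); last first.
    by apply/funext => k; rewrite /norm_inv MI.
  exact: (metric_dist_cvg Hdot maxA beta_gt0 cocoB alpha_gt0 eta0 etac U_P UM MU U_incr
    gamma0 gammaU lambda0 lambda1 suma sumb xS Oxs).
have low0 : 0 < lambda_low by have [] := lP 0%N.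
have tau0 : 0 < tau by have [_ _ _ /andP[]] := lP 0%N.
have ltau k : lambda_low * tau <= lambda k *
    (2 - gamma k * opnorm (U k) / (2 * beta) - lambda k).
  have [_ h1 h2 _] := lP k; move: h2; rewrite alphaE => h2.
  by apply: ler_pM; rewrite ?(ltW low0) ?(ltW tau0)//; lra.
have res := metric_residual_cvg0 Hdot maxA beta_gt0 cocoB alpha_gt0 eta0 etac U_P UM MU
  U_incr gamma0 gammaU lambda0 lambda1 suma sumb xS Oxs0 (mulr_gt0 low0 tau0) ltau.
split; first exact: (residual_norm_cvg0 Hdot alpha_gt0 U_P UM muU res).
move=> gamma_low glow0 glow; split.
  exact: (x_weakly_cvg Hdot maxA beta_gt0 cocoB alpha_gt0 eta0 etac U_P UM MU muU
    U_incr gamma0 gammaU lambda0 lambda1 suma sumb xS res glow0 glow Oxs0).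
move=> eps _ _ xs Oxs.
exact: (Bx_cvg Hdot maxA beta_gt0 cocoB alpha_gt0 eta0 etac U_P UM MU muU
    U_incr gamma0 gammaU lambda0 lambda1 suma sumb xS res glow0 glow Oxs).
Qed.
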